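(* Let $M$ be a matroid on a nonempty finite ground set with a cycle system $\mathcal{C}=\{C_1,\dots,C_g\}$, where $g=g(M)$. 1. There exists an element $e\in E(M)$ such that both the deletion $M\setminus e$ and the contraction $M/e$ admit cycle systems. 2. If $M$ is connected, then each $C_i$ is a circuit of $M$. 3. If $M$ is not connected, then the connected components can be ordered so that, writing $M=M_1\oplus\cdots\oplus M_k$ for the decomposition of $M$ into connected components in this order, there are circuit systems $\mathcal{C}^{(i)}$ for $M_i$ $(1\le i\le k)$ such that $\mathcal{C}$ is the disjoint union of sets $\widetilde{\mathcal{C}}^{(1)},\dots,\widetilde{\mathcal{C}}^{(k)}$ of the form $$\widetilde{\mathcal{C}}^{(i)}=\{K_C\cup C : C\in\mathcal{C}^{(i)}\},$$ where each $K_C$ is either empty or a cycle contained in $\bigoplus_{j=1}^{i-1}M_j$. In particular $\widetilde{\mathcal{C}}^{(1)}=\mathcal{C}^{(1)}$. 4. If $M$ is connected and binary, then $\mathcal{C}$ is a basis for the circuit space of $M$; that is, the indicator vectors of $C_1,\dots,C_g$ form a basis of the circuit space of $M$.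
   Context: Matroids are on finite ground sets; $E(M)$ is the ground set, $r(M)$ the rank, and $g(M)=|E(M)|-r(M)$ the corank. A *cycle* of $M$ is a union of circuits of $M$ (equivalently, a subset $K\subseteq E(M)$ such that the restriction $M|K$ has no bridges (coloops)). For a loop $e$, $M/e$ means $M\setminus e$. Unique union: for a family $\mathcal{A}=\{A_1,\dots,A_g\}$ of subsets of a set and $\sigma\subseteq[g]=\{1,\dots,g\}$, $\mathcal{A}_\sigma$ is the set of elements $e\in\bigcup_{i\in\sigma}A_i$ for which there is exactly one $i\in\sigma$ with $e\in A_i$. A *cycle system* for $M$ is a collection $\mathcal{C}=\{C_1,\dots,C_g\}$ of cycles of $M$ with $g=g(M)$ such that for every nonempty $\sigma\subseteq[g]$ the unique union $\mathcal{C}_\sigma$ is dependent in $M$. A *circuit system* is a cycle system all of whose elements are circuits. $M$ is *connected* if any two distinct elements of $E(M)$ lie in a common circuit; a connected component is a maximal subset $T$ of the ground set such that $M|T$ is connected, and $M$ is the direct sum of the restrictions to its connected components. The *circuit space* of $M$ is the subspace of the $\mathbb{F}_2$-vector space with basis $E(M)$ spanned by the indicator vectors of circuits of $M$. *)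

(* Defs.v *)
From HB Require Import structures.
From mathcomp Require Import all_boot all_order all_algebra.

Set Implicit Arguments.
Unset Strict Implicit.
Unset Printing Implicit Defensive.

(* The ground set is a subset of an ambient finite type, so that minors of a
   matroid live over the same type. *)
Record matroid (T : finType) := Matroid {
  ground : {set T};
  indep : pred {set T};
  indep_ground : forall I : {set T}, indep I -> I \subset ground;
  indep0 : indep set0;
  indepS : forall I J : {set T}, I \subset J -> indep J -> indep I;
  indep_aug : forall I J : {set T}, indep I -> indep J -> #|I| < #|J| ->
    exists2 x, x \in J :\: I & indep (x |: I)
}.

Section Matroids.
Variable T : finType.
Implicit Types (M : matroid T) (A C D I J K : {set T}) (e : T).

Definition rank M : nat := \max_(I : {set T} | indep M I) #|I|.
Definition corank M : nat := #|ground M| - rank M.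

Definition dependent M D : bool := (D \subset ground M) && ~~ indep M D.

Definition circuit M C : bool := minset (dependent M) C.

(* The empty union is allowed: set0 is a cycle. *)
Definition matroid_cycle M K : bool :=
  [exists S : {set {set T}}, [forall C in S, circuit M C] && (K == cover S)].

Section Restriction.
Variables (M : matroid T) (A : {set T}).

Definition restrict_indep : pred {set T} :=
  [pred I : {set T} | indep M I && (I \subset A)].

Fact restrict_ground I : restrict_indep I -> I \subset ground M :&: A.
Proof. by case/andP=> /indep_ground sIM sIA; rewrite subsetI sIM. Qed.

Fact restrict_indep0 : restrict_indep set0.
Proof. by rewrite /restrict_indep /= indep0 sub0set. Qed.

Fact restrict_indepS I J : I \subset J -> restrict_indep J -> restrict_indep I.
Proof.
by move=> sIJ /andP[iJ sJA]; rewrite /restrict_indep /= (indepS sIJ iJ) (subset_trans sIJ sJA).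
Qed.

Fact restrict_indep_aug I J :
    restrict_indep I -> restrict_indep J -> #|I| < #|J| ->
  exists2 x, x \in J :\: I & restrict_indep (x |: I).
Proof.
case/andP=> iI sIA /andP[iJ sJA] /(indep_aug iI iJ)[x xJI ixI]; exists x => //.
by rewrite /restrict_indep /= ixI subUset sub1set sIA (subsetP sJA) //; case/setDP: xJI.
Qed.

Definition restrict : matroid T :=
  Matroid restrict_ground restrict_indep0 restrict_indepS restrict_indep_aug.

End Restriction.

Definition delete M e : matroid T := restrict M (ground M :\ e).

Section Contraction.
Variables (M : matroid T) (e : T).

(* When [set e] is not independent (e is a loop), contraction is deletion. *)
Definition contract_indep : pred {set T} :=
  [pred I : {set T} | (e \notin I) &&
    (if indep M [set e] then indep M (e |: I) else indep M I)].

Fact contract_ground I : contract_indep I -> I \subset ground M :\ e.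
Proof.
case/andP=> eI iI; rewrite subsetD1 eI andbT.
case: ifP iI => _ /indep_ground //; exact/subset_trans/subsetUr.
Qed.

Fact contract_indep0 : contract_indep set0.
Proof. by rewrite /contract_indep /= inE setU0 indep0; case: ifP. Qed.

Fact contract_indepS I J : I \subset J -> contract_indep J -> contract_indep I.
Proof.
move=> sIJ /andP[eJ iJ]; rewrite /contract_indep /= (contra (subsetP sIJ e) eJ) /=.
by case: ifP iJ => _; apply/indepS => //; apply: setUS.
Qed.

Fact contract_indep_aug I J :
    contract_indep I -> contract_indep J -> #|I| < #|J| ->
  exists2 x, x \in J :\: I & contract_indep (x |: I).
Proof.
rewrite /contract_indep /=; case: ifP => _ /andP[eI iI] /andP[eJ iJ] ltIJ.
  have [|x] := indep_aug iI iJ; first by rewrite !cardsU1 eI eJ.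
  rewrite !inE negb_or => /andP[/andP[/negPf xe xI] xJ] ix.
  exists x; rewrite ?inE; first by rewrite xI; move: xJ; rewrite xe.
  by rewrite negb_or eq_sym xe eI setUCA.
have [x xJI ix] := indep_aug iI iJ ltIJ; exists x => //.
rewrite ix !inE negb_or eI !andbT.
by apply: contraNneq eJ => ->; case/setDP: xJI.
Qed.

Definition contract : matroid T :=
  Matroid contract_ground contract_indep0 contract_indepS contract_indep_aug.

End Contraction.

Definition connected M : bool :=
  [forall x in ground M, forall y in ground M, (x != y) ==>
    [exists C : {set T}, [&& circuit M C, x \in C & y \in C]]].

Definition components M : {set {set T}} :=
  [set A | maxset [pred B : {set T} |
                     (B \subset ground M) && connected (restrict M B)] A].

Definition is_direct_sum M k (N : 'I_k -> matroid T) : Prop :=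
  [/\ ground M = \bigcup_(i < k) ground (N i),
      forall i j, i != j -> [disjoint ground (N i) & ground (N j)]
    & forall I, I \subset ground M ->
        indep M I = [forall i, indep (N i) (I :&: ground (N i))]].

Definition unique_union g (C : 'I_g -> {set T}) (s : {set 'I_g}) : {set T} :=
  [set e | #|[set i in s | e \in C i]| == 1].

Definition cycle_system M g (C : 'I_g -> {set T}) : Prop :=
  [/\ g = corank M,
      forall i, matroid_cycle M (C i)
    & forall s : {set 'I_g}, s != set0 -> dependent M (unique_union C s)].

Definition circuit_system M g (C : 'I_g -> {set T}) : Prop :=
  cycle_system M C /\ forall i, circuit M (C i).

Definition has_cycle_system M : Prop :=
  exists g (C : 'I_g -> {set T}), cycle_system M C.

(* Representability over 'F_2; values of v off the ground set play no role. *)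
Definition binary M : Prop :=
  exists n (v : T -> 'rV['F_2]_n), forall I, I \subset ground M ->
    indep M I = free [seq v x | x <- enum I].

(* Vectors are indexed by the ambient type; the coordinates outside the ground
   set vanish on the circuit space. *)
Definition indicator A : {ffun T -> ('F_2)^o} :=
  [ffun x => (x \in A)%:R%R].

Definition circuit_space M : {vspace {ffun T -> ('F_2)^o}} :=
  <<[seq indicator C | C <- enum (circuit M)]>>%VS.

End Matroids.

(* Main.v *)
Require Import Defs.
From HB Require Import structures.
From mathcomp Require Import all_boot all_order all_algebra.
From mathcomp Require Import zify.

(* A matroid is handled through its nullity X |-> |X| - r(X), a monotone
   supermodular function f with unit increments: a set is dependent when f is
   positive on it, a cycle when removing any of its elements lowers f, and
   contracting e replaces f by X |-> f(X + e) - f(e).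

   The heart of the matter is that a cycle system on a nonempty matroid has a
   "tight" connected component A: exactly f(A) of the cycles lie in A, and these
   are circuits.  The unique union of the whole system is nonempty, so some e lies
   in a single cycle C_i.  Removing C_i gives a cycle system for the deletion of e,
   removing e from all cycles gives one for the contraction, and by induction both
   minors have a tight component.  Let B be that of the contraction.  If C_i - e is
   not in B then e is a coloop of B + e, and B is a tight component of M.  If C_i - e
   is in B, it is a circuit, hence so is C_i.  If moreover B + e is not a component,
   contracting e disconnects the component A of e, so by Tutte's theorem A - e is
   connected, and the tight component of the deletion is either A - e, making A
   tight, or a component of M.

   For a tight component A, the traces outside A of the remaining cycles form a
   cycle system: burning the cycles inside A one at a time shows that some of them
   can be added to any subfamily so that its unique union becomes independent on A.
   Iterating yields the decomposition.  In the binary case the cycles are linearly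
   independent since a vanishing combination has no coordinate at which exactly one
   of its members is nonzero. *)

Set Implicit Arguments.
Unset Strict Implicit.
Unset Printing Implicit Defensive.

(** * Nullity functions and connectivity *)

Ltac set_cases z :=
  repeat match goal with
  | |- context [z == ?e] =>
      have [->|_] := eqVneq z e
  end.

(* Decides inclusions between Boolean combinations of sets, using the
   inclusions among the hypotheses. *)
Ltac set_sub :=
  let z := fresh "z" in
  apply/subsetP=> z;
  repeat match goal with H : is_true (_ \subset _) |- _ =>
    move: (subsetP H z); clear H end;
  rewrite !inE; set_cases z; rewrite /= ?eqxx;
  repeat match goal with H : is_true (?a != ?b) |- _ =>
    rewrite ?(negbTE H) ?[b == a]eq_sym ?(negbTE H); clear H end;
  repeat match goal with |- context [?a == ?b] =>
    let H := fresh in have [H|_] := eqVneq a b; [subst a|] end;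
  repeat match goal with H : is_true (_ \in _) |- _ => rewrite ?H; clear H end;
  repeat match goal with H : is_true (_ \notin _) |- _ => rewrite ?(negbTE H); clear H end;
  repeat match goal with |- context [?x \in ?A] => case: (x \in A) end;
  rewrite /= ?implybT //; try tauto; auto.

(* [lia] on the inequalities between cardinals and nullities only: hypotheses
   about sets slow it down by orders of magnitude. *)
Ltac nat_lia :=
  repeat match goal with
  | H : is_true (leq _ _) |- _ => revert H
  | H : @eq nat _ _ |- _ => revert H
  end;
  repeat match goal with
  | |- context [?f ?X] =>
      lazymatch type of f with {set _} -> nat => idtac end;
      generalize (f X); intro
  | |- context [#|?X|] => generalize #|X|; intro
  end;
  repeat match goal with
  | H : ?P |- _ => lazymatch P with nat => fail | _ => clear H end
  end;
  lia.

Section Nullity.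
Variable T : finType.
Implicit Types (f : {set T} -> nat) (A B E K W X Y : {set T}) (e x y : T).

(** These axioms say that [X |-> #|X| - f X] is a matroid rank function on all of [T]. Deletion then
    keeps [f] and only shrinks the ground set [E]. *)
Record nullity_fun f : Prop := NullityFun {
  nul0 : f set0 = 0;
  nulS : forall X Y, X \subset Y -> f X <= f Y;
  nulU1 : forall e X, f (e |: X) <= (f X).+1;
  nul_super : forall X Y, f X + f Y <= f (X :|: Y) + f (X :&: Y)
}.

Definition contr f e X : nat := f (e |: X) - f [set e].
Definition ncycle f K : Prop := forall x, x \in K -> f (K :\ x) < f K.
(** For a nullity function supermodularity gives the reverse inequality, so [E] is the direct sum of
    [A] and its complement: [A] is a union of connected components. *)
Definition nsep f E A : bool := (A \subset E) && (f E <= f A + f (E :\: A)).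
Definition nconn f A : bool :=
  [forall X : {set T}, nsep f A X ==> (X == set0) || (X == A)].
Definition component f E A : Prop := [/\ A != set0, nsep f E A & nconn f A].

Section One.
Variables (f : {set T} -> nat) (fN : nullity_fun f).

Lemma super_sub X Y (U I : {set T}) : X :|: Y \subset U -> X :&: Y \subset I ->
  f X + f Y <= f U + f I.
Proof.
move=> sU sI; apply: leq_trans (nul_super fN X Y) _.
by apply: leq_add; apply: nulS.
Qed.

Lemma nulD1 e X : f X <= (f (X :\ e)).+1.
Proof. apply: leq_trans (nulU1 fN e _); apply: nulS => //; set_sub. Qed.

Lemma super_disjoint X Y (U : {set T}) : X :|: Y \subset U -> X :&: Y \subset set0 ->
  f X + f Y <= f U.
Proof. by move=> sU /(super_sub sU); rewrite (nul0 fN) addn0. Qed.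

(** Supermodularity is applied to [K] and [W :\ x], whose union is [W] and whose intersection is
    [K :\ x]: an element of a cycle is a coloop of no larger set. *)
Lemma ncycle_lt K W x : ncycle f K -> K \subset W -> x \in K -> f (W :\ x) < f W.
Proof.
move=> cK sKW xK; have := cK _ xK.
have sub1 : K :|: W :\ x \subset W by set_sub.
have sub2 : K :&: (W :\ x) \subset K :\ x by set_sub.
have := super_sub sub1 sub2; nat_lia.
Qed.

(** Two uses of supermodularity: for [X] and [A], then for their union and [E :\: A]. *)
Lemma nsep_split E A X : nsep f E A -> X \subset E -> f X = f (X :&: A) + f (X :\: A).
Proof.
case/andP=> sAE sep sXE; apply/eqP; rewrite eqn_leq; apply/andP; split; last first.
  apply: super_disjoint; set_sub.
have := @super_sub X A _ _ (subxx _) (subxx _).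
have sub1 : (X :|: A) :|: (E :\: A) \subset E by set_sub.
have sub2 : (X :|: A) :&: (E :\: A) \subset X :\: A by set_sub.
have := super_sub sub1 sub2; nat_lia.
Qed.

Lemma nsepE E A : nsep f E A -> f E = f A + f (E :\: A).
Proof.
by move=> sA; have /andP[sAE _] := sA; rewrite (nsep_split sA (subxx _)) (setIidPr sAE).
Qed.

Lemma nsepC E A : nsep f E A -> nsep f E (E :\: A).
Proof.
case/andP=> sAE sep; apply/andP; split; first by apply: subsetDl.
by rewrite setDDr setDv set0U (setIidPr sAE) addnC.
Qed.

Lemma nsep_trans E A X : nsep f E A -> nsep f A X -> nsep f E X.
Proof.
move=> sA /andP[sXA sX]; have /andP[sAE _] := sA.
apply/andP; split; first exact: subset_trans sAE.
have := nsepE sA.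
have sub1 : (A :\: X) :|: (E :\: A) \subset E :\: X by set_sub.
have sub2 : (A :\: X) :&: (E :\: A) \subset set0 by set_sub.
have := super_disjoint sub1 sub2; nat_lia.
Qed.

Lemma nsepI E A B : nsep f E A -> B \subset E -> nsep f B (B :&: A).
Proof.
move=> sA sBE; apply/andP; split; first exact: subsetIl.
by rewrite (nsep_split sA sBE) setDIr setDv set0U.
Qed.

Lemma nconnP A X : nconn f A -> nsep f A X -> X = set0 \/ X = A.
Proof. by move/forallP/(_ X)/implyP=> h /h /orP[] /eqP; [left | right]. Qed.

Lemma ncycleD E A K : nsep f E A -> ncycle f K -> K \subset E -> ncycle f (K :\: A).
Proof.
move=> sA cK sKE x; rewrite inE => /andP[xA xK]; have := cK x xK.
rewrite (nsep_split sA sKE) (nsep_split sA (subset_trans (subD1set K x) sKE)).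
have -> : (K :\ x) :\: A = (K :\: A) :\ x by rewrite !setDDl setUC.
suff -> : (K :\ x) :&: A = K :&: A by rewrite ltn_add2l.
by apply/setP=> z; rewrite !inE; have [->|] := eqVneq z x; rewrite //= (negbTE xA) andbF.
Qed.

(** The trace of [B] on the separator [A] separates [B], and it contains [x]. *)
Lemma nconn_sub E A B x : nsep f E A -> nconn f B -> B \subset E ->
  x \in B -> x \in A -> B \subset A.
Proof.
move=> sA cB sBE xB xA; case: (nconnP cB (nsepI sA sBE)) => [h|/setIidPl //].
by have := in_set0 x; rewrite -h inE xB xA.
Qed.

(** A smallest separator containing [x] is connected: a proper separator of it, or the complement of
    that one, would be a smaller choice. *)
Lemma component_at E x : x \in E -> exists2 A, component f E A & x \in A.
Proof.
move=> xE.
have sE : nsep f E E && (x \in E) by rewrite /nsep subxx setDv leq_addr.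
case: (@arg_minnP _ E (fun A => nsep f E A && (x \in A)) (fun A => #|A|) sE).
move=> A /andP[sA xA] minA; exists A => //; split=> //.
  by apply/set0Pn; exists x.
apply/forallP=> X; apply/implyP=> sX; have /andP[sXA _] := sX.
have [xX|xX] := boolP (x \in X).
  have := minA X; rewrite (nsep_trans sA sX) xX => /(_ isT) le.
  by rewrite orbC eqEcard sXA le.
have := minA (A :\: X); rewrite (nsep_trans sA (nsepC sX)) inE xX xA => /(_ isT).
rewrite cardsD (setIidPr sXA) => le.
have := subset_leq_card sXA; have : 0 < #|A| by apply/card_gt0P; exists x.
by move=> h1 h2; rewrite -cards_eq0; apply/orP; left; nat_lia.
Qed.

(** Both sides of a proper separation miss an element of [K], so both have nullity 0, against
    [f K = 1]. *)
Lemma circuit_nconn K : ncycle f K -> f K = 1 -> nconn f K.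
Proof.
move=> cK K1; apply/forallP=> X; apply/implyP=> /andP[sXK].
have [//|/set0Pn[x xX]] := eqVneq X set0.
have [->|nXK] := eqVneq X K; first by rewrite orbT.
have [y yK yX] : exists2 y, y \in K & y \notin X.
  by apply/subsetPn; rewrite eqEsubset sXK in nXK.
have := cK x (subsetP sXK x xX); have := cK y yK; rewrite K1 => lty ltx.
have s1 : X \subset K :\ y by set_sub.
have s2 : K :\: X \subset K :\ x by set_sub.
have := nulS fN s1; have := nulS fN s2; nat_lia.
Qed.

(** Keeps the truncated subtraction in [contr] exact. *)
Lemma contr_ge e X : f [set e] <= f (e |: X).
Proof. by apply: nulS => //; set_sub. Qed.

Lemma contr_nullity e : nullity_fun (contr f e).
Proof.
split; rewrite /contr.
- by rewrite setU0 subnn.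
- by move=> X Y sXY; apply: leq_sub2r; apply: nulS => //; apply: setUS.
- move=> x X; have := nulU1 fN x (e |: X); rewrite setUCA.
  by have := contr_ge e X; have := contr_ge e (x |: X); nat_lia.
move=> X Y; have := contr_ge e X; have := contr_ge e Y.
have := contr_ge e (X :|: Y); have := contr_ge e (X :&: Y).
have := @super_sub (e |: X) (e |: Y) (e |: (X :|: Y)) (e |: (X :&: Y)).
have s1 : (e |: X) :|: (e |: Y) \subset e |: (X :|: Y) by set_sub.
have s2 : (e |: X) :&: (e |: Y) \subset e |: (X :&: Y) by set_sub.
by move/(_ s1 s2); nat_lia.
Qed.

Lemma ncycle_contr K e : ncycle f K -> ncycle (contr f e) (K :\ e).
Proof.
move=> cK x; rewrite !inE => /andP[xe xK]; rewrite /contr.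
apply: ltn_sub2r.
  have s : [set e] \subset e |: (K :\ e) :\ x by set_sub.
  apply: leq_ltn_trans (nulS fN s) _.
  have s2 : e |: K :\ e :\ x \subset (e |: K) :\ x by set_sub.
  apply: leq_ltn_trans (nulS fN s2) _.
  have s3 : e |: K \subset e |: K :\ e by set_sub.
  apply: leq_trans (nulS fN s3); apply: ncycle_lt cK _ xK; set_sub.
have s2 : e |: K :\ e :\ x \subset (e |: K) :\ x by set_sub.
apply: leq_ltn_trans (nulS fN s2) _.
have s3 : e |: K \subset e |: K :\ e by set_sub.
apply: leq_trans (nulS fN s3); apply: ncycle_lt cK _ xK; set_sub.
Qed.

Lemma nconnPn A : ~~ nconn f A -> exists X,
  [/\ X \subset A, f A <= f X + f (A :\: X), X != set0 & A :\: X != set0].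
Proof.
case/forallPn=> X; rewrite negb_imply negb_or => /andP[/andP[sXA sep] /andP[X0 XA]].
by exists X; split=> //; rewrite setD_eq0; rewrite eqEsubset sXA in XA.
Qed.

(* Uncrossing a separation of the deletion with one of the contraction. *)
Lemma tutte_uncross A e X X' : nconn f A -> e \in A ->
  X \subset A :\ e -> f (A :\ e) <= f X + f (A :\ e :\: X) ->
  X' \subset A :\ e -> contr f e (A :\ e) <= contr f e X' + contr f e (A :\ e :\: X') ->
  X :&: X' = set0 \/ (A :\ e :\: X) :&: (A :\ e :\: X') = set0.
Proof.
move=> cA eA; set Y := A :\ e :\: X; set Y' := A :\ e :\: X'.
rewrite /contr setD1K // => sX sepX sX'.
have := contr_ge e X'; have := contr_ge e Y'.
have : f [set e] <= f A by rewrite -(setD1K eA) contr_ge.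
move=> geA geY' geX' sepX'.
have u1 : X :|: (e |: X') \subset e |: (X :|: X') by set_sub.
have i1 : X :&: (e |: X') \subset X :&: X' by set_sub.
have u2 : Y :|: (e |: Y') \subset e |: (Y :|: Y') by set_sub.
have i2 : Y :&: (e |: Y') \subset Y :&: Y' by rewrite /Y /Y'; set_sub.
have := super_sub u1 i1; have := super_sub u2 i2; have := nulD1 e A => h1 h2 h3.
have s1 : X :&: X' \subset A by set_sub.
have s2 : Y :&: Y' \subset A by rewrite /Y /Y'; set_sub.
have s3 : e |: (Y :|: Y') \subset A :\: (X :&: X') by rewrite /Y /Y'; set_sub.
have s4 : e |: (X :|: X') \subset A :\: (Y :&: Y') by rewrite /Y /Y'; set_sub.
have := nulS fN s3; have := nulS fN s4 => h4 h5.
(* Deleting [e] costs at most one, so the two right-hand sides add up to at least [2 * f A - 1] and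
   one of them reaches [f A]. Neither corner contains [e], so a separating corner is empty. *)
have : (f A <= f (X :&: X') + f (A :\: (X :&: X'))) ||
       (f A <= f (Y :&: Y') + f (A :\: (Y :&: Y'))) by nat_lia.
case/orP=> sep; [left | right].
  have [//|h] := nconnP cA (introT andP (conj s1 sep)).
  by move: eA; rewrite -h inE => /andP[/(subsetP sX)]; rewrite !inE eqxx.
have [//|h] := nconnP cA (introT andP (conj s2 sep)).
by move: eA; rewrite -h !inE eqxx !andbF.
Qed.

(** If both minors had separations, uncrossing [X] with [X'] and with its complement would make two
    of the four intersections empty, and in each case one of the four sides is then empty. *)
Lemma tutte A e : nconn f A -> e \in A ->
  nconn f (A :\ e) \/ nconn (contr f e) (A :\ e).
Proof.
move=> cA eA; have [|/nconnPn[X [sX sepX X0 Y0]]] := boolP (nconn f (A :\ e)); first by left.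
right; apply/negPn/negP=> /forallPn[X']; rewrite negb_imply negb_or.
case/andP=> /andP[sX' sepX'] /andP[X'0 XA'].
have Y'0 : A :\ e :\: X' != set0 by rewrite setD_eq0; rewrite eqEsubset sX' in XA'.
have sY' : A :\ e :\: X' \subset A :\ e by apply: subsetDl.
have eqX' : A :\ e :\: (A :\ e :\: X') = X'.
  by rewrite setDDr setDv set0U (setIidPr sX').
have := tutte_uncross cA eA sX sepX sX' sepX'.
have := tutte_uncross cA eA sX sepX sY'; rewrite eqX' addnC => /(_ sepX').
move: X0 Y0 X'0 Y'0 => /set0Pn[x xX] /set0Pn[y yY] /set0Pn[x' xX'] /set0Pn[y' yY'].
have := subsetP sX x xX; have := subsetP sX' x' xX'.
set P := A :\ e in sX sX' yY yY' * => x'P xP h1 h2; clearbody P.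
move: yY yY'; rewrite !in_setD => /andP[yX yP] /andP[yX' y'P].
case: h1 => /setP h1; case: h2 => /setP h2;
  move: (h1 x) (h1 y) (h1 x') (h1 y') (h2 x) (h2 y) (h2 x') (h2 y');
 rewrite !(in_setI, in_setD, in_set0) xX (negbTE yX) xX' (negbTE yX') xP yP x'P y'P /= ?andbT;
 do !case: (_ \in _) => //=.
Qed.

End One.

(** Induction on [#|A|]: Tutte's theorem removes any third element [e] by deletion or contraction,
    and a circuit of the minor through [x] and [y] is lifted. *)
Lemma nconn_circuit f A x y : nullity_fun f -> nconn f A ->
  x \in A -> y \in A -> x != y ->
  exists C : {set T}, [/\ C \subset A, x \in C, y \in C, ncycle f C & f C = 1].
Proof.
have [n leA] := ubnP #|A|; elim: n => // n IHn in f A leA *.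
move=> fN cA xA yA xy.
(* A loop would be a separator by itself. *)
have noloop z t : z \in A -> t \in A -> t != z -> f [set z] = 0.
  move=> zA tA tz; apply/eqP; rewrite -leqn0 leqNgt; apply/negP=> loop.
  have sep : nsep f A [set z].
    by rewrite /nsep sub1set zA (leq_trans (nulD1 fN z A)) // -add1n leq_add2r.
  have [/setP/(_ z)|/setP/(_ t)] := nconnP cA sep; first by rewrite !inE eqxx.
  by rewrite !inE tA (negbTE tz).
have [e /andP[eA exy]|noe] := pickP [pred e | (e \in A) && (e \notin [set x; y])]; last first.
  have eqA : A = [set x; y].
    apply/eqP; rewrite eqEsubset subUset !sub1set xA yA !andbT.
    by apply/subsetP=> z zA; have := noe z; rewrite inE zA /= => /negbFE.
  have fx := noloop x y xA yA; rewrite eq_sym xy in fx.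
  have fy := noloop y x yA xA xy.
  have Ax : A :\ x = [set y] by apply/setP=> z; rewrite eqA !inE;
    have [->|] := eqVneq z x; rewrite //= (negbTE xy).
  have Ay : A :\ y = [set x] by apply/setP=> z; rewrite eqA !inE orbC;
    have [->|] := eqVneq z y; rewrite //= eq_sym (negbTE xy).
  have A1 : f A = 1.
    apply/eqP; rewrite eqn_leq; apply/andP; split.
      by have := nulD1 fN x A; rewrite Ax fy.
    rewrite lt0n; apply/negP=> /eqP A0.
    have sep : nsep f A [set x] by rewrite /nsep sub1set xA A0.
    have [/setP/(_ x)|/setP/(_ y)] := nconnP cA sep; first by rewrite !inE eqxx.
    by rewrite !inE yA eq_sym (negbTE xy).
  exists A; split=> // z; rewrite {1}eqA !inE A1.
  by case/orP=> /eqP->; rewrite ?Ax ?Ay ?fx ?fy.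
move: exy; rewrite !inE negb_or => /andP[ex ey].
have xe : x \in A :\ e by rewrite !inE eq_sym ex.
have ye : y \in A :\ e by rewrite !inE eq_sym ey.
have ltA : #|A :\ e| < n by move: leA; rewrite (cardsD1 e) eA.
have [cD|cC] := tutte fN cA eA.
  have [C [sC xC yC cC C1]] := IHn f _ ltA fN cD xe ye xy.
  by exists C; split=> //; apply: subset_trans sC (subD1set _ _).
have [D [sD xD yD cD D1]] := IHn _ _ ltA (contr_nullity fN e) cC xe ye xy.
have fe : f [set e] = 0 by apply: noloop xA _; rewrite // eq_sym.
have eD : e \notin D by apply/negP=> /(subsetP sD); rewrite !inE eqxx.
move: D1 cD; rewrite /ncycle /contr fe !subn0 => De cD.
have cD' z : z \in D -> f (e |: D :\ z) = 0.
  by move/cD; rewrite De; case: (f _).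
(* A circuit [D] of the contraction is already a circuit if it is dependent, and becomes one after
   adding [e] otherwise. *)
have [D0|D1] := posnP (f D).
  exists (e |: D); split; rewrite ?setU1r //.
    by rewrite subUset sub1set eA (subset_trans sD (subD1set _ _)).
  move=> z; rewrite De !inE => /predU1P[->|zD]; first by rewrite setU1K // D0.
  rewrite -(cD' z zD) ltnS; apply: nulS => //; set_sub.
have D1' : f D = 1.
  apply/eqP; rewrite eqn_leq D1 andbT -De; apply: nulS => //; set_sub.
exists D; split=> //; first by apply: subset_trans sD (subD1set _ _).
move=> z zD; rewrite D1' -(cD' z zD) ltnS; apply: nulS => //; set_sub.
Qed.

End Nullity.

(** * Cycle systems of a nullity function *)

Section System.
Variables (T : finType) (g : nat).
Implicit Types (f : {set T} -> nat) (A B E K W X Y : {set T}) (e x y : T).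
Implicit Types (S s t : {set 'I_g}) (C : 'I_g -> {set T}).

Record nullity_system f E S C : Prop := NullitySystem {
  sys_card : #|S| = f E;
  sys_sub : forall i, i \in S -> C i \subset E;
  sys_cyc : forall i, i \in S -> ncycle f (C i);
  sys_dep : forall s, s \subset S -> s != set0 -> 0 < f (unique_union C s)
}.

Definition inside S C A : {set 'I_g} := [set i in S | C i \subset A].

Definition tight f S C A : Prop := #|inside S C A| = f A.

Lemma unique_unionP C s e :
  reflect (exists2 i, (i \in s) && (e \in C i) & forall j, j \in s -> e \in C j -> j = i)
          (e \in unique_union C s).
Proof.
rewrite inE; apply: (iffP cards1P) => [[i /setP eqi]|[i /andP[si Cie] uni]]; exists i.
  by have := eqi i; rewrite !inE eqxx.
  by move=> j sj Cj; have := eqi j; rewrite !inE sj Cj => /esym/eqP.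
apply/setP=> j; rewrite !inE; have [->|ji] := eqVneq j i; first by rewrite si Cie.
by apply/negP=> /andP[sj Cj]; rewrite (uni j sj Cj) eqxx in ji.
Qed.

Lemma unique_union_cover C s e : e \in unique_union C s -> exists2 i, i \in s & e \in C i.
Proof. by case/unique_unionP=> i /andP[]; exists i. Qed.

Lemma mem_unique_union C s i e : i \in s -> e \in C i ->
  (forall j, j \in s -> e \in C j -> j = i) -> e \in unique_union C s.
Proof. by move=> si Ci uni; apply/unique_unionP; exists i; rewrite ?si. Qed.

Lemma unique_unionD C s X : unique_union (fun i => C i :\: X) s = unique_union C s :\: X.
Proof.
apply/setP=> z; rewrite in_setD; apply/unique_unionP/andP=> [[i]|[zX /unique_unionP[i]]].
  rewrite inE => /and3P[si zX Ci] uni; split=> //.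
  by apply/unique_unionP; exists i; rewrite ?si // => j sj Cj; apply: uni; rewrite // inE zX.
by move=> sCi uni; exists i; rewrite ?inE ?zX // => j sj; rewrite inE zX; apply: uni.
Qed.

Lemma eq_unique_union C C' s : {in s, C =1 C'} -> unique_union C s = unique_union C' s.
Proof.
move=> eqC; apply/setP=> z; rewrite !inE; congr (_ == _); apply: eq_card => i.
by rewrite !inE; case: (boolP (i \in s)) => [/eqC->|].
Qed.

(** Serves to exclude repeated members, since the unique union of the pair would have to be
    dependent. *)
Lemma unique_union_pair C l m : l != m -> C l = C m ->
  unique_union C [set l; m] = set0.
Proof.
move=> lm eqC; apply/setP=> z; rewrite in_set0; apply/negP=> /unique_unionP[i /andP[ilm Ci] uni].
have zl : z \in C l by case/set2P: ilm => ii; [|rewrite eqC]; rewrite -ii.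
have li := uni l (set21 l m) zl; rewrite eqC in zl.
by have mi := uni m (set22 l m) zl; rewrite li mi eqxx in lm.
Qed.

(** Positive nullity forces the unique union to be nonempty; the private element found there drives
    the inductions on subfamilies. *)
Lemma sys_dep_ex f E S C s :
  nullity_fun f -> nullity_system f E S C -> s \subset S -> s != set0 ->
  exists e i, [/\ i \in s, e \in C i, e \in unique_union C s
                & forall j, j \in s -> e \in C j -> j = i].
Proof.
move=> fN sC sS s0; have := sys_dep sC sS s0.
have [->|/set0Pn[e euu] _] := eqVneq (unique_union C s) set0; first by rewrite (nul0 fN).
by have /unique_unionP[i /andP[? ?]] := euu; exists e, i.
Qed.

(** Dropping a member together with an element private to it leaves the other members inside
    [W :\ e], and the nullity of [W] falls because the dropped member is a cycle through [e]. *)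
Lemma card_le_nullity f E S C s W : nullity_fun f -> nullity_system f E S C -> s \subset S ->
  (forall i, i \in s -> C i \subset W) -> #|s| <= f W.
Proof.
move=> fN sC; have [n] := ubnP #|s|; elim: n => // n IHn in s W * => les sS CW.
have [->|s0] := eqVneq s set0; first by rewrite cards0.
have [e [i [si Ci _ uni]]] := sys_dep_ex fN sC sS s0.
have := ncycle_lt fN (sys_cyc sC (subsetP sS i si)) (CW i si) Ci.
move=> ltW; move: les; rewrite (cardsD1 i s) si ltnS => les.
suff: #|s :\ i| <= f (W :\ e) by nat_lia.
apply: IHn => //; first exact: subset_trans (subD1set _ _) sS.
move=> j; rewrite !inE => /andP[ji sj]; rewrite subsetD1 CW //=.
by apply: contra ji => Cj; rewrite (uni j sj Cj).
Qed.

(* Burning: the members of [s] are removed one at a time, each together with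
   an element that no other remaining set covers; [W] is what is left of [A]. *)
Lemma burn f E S C s t A W : nullity_fun f -> nullity_system f E S C -> s \subset S ->
  t \subset ~: s -> W \subset A -> f W <= #|s| ->
  (forall i, i \in s -> C i \subset W) ->
  unique_union C (t :|: s) :&: A \subset W ->
  exists2 s' : {set 'I_g}, s' \subset s & f (unique_union C (t :|: s') :&: A) = 0.
Proof.
move=> fN sC; have [n] := ubnP #|s|; elim: n => // n IHn in s W *.
move=> les sS ts sWA fW CW QW; set Q := unique_union C (t :|: s) :&: A in QW.
have [Q0|Q0] := posnP (f Q); first by exists s.
(* If no remaining member meets [Q], then [Q] is disjoint from their union, whose nullity is at
   least [#|s|]. Since [f W <= #|s|], this leaves nullity 0 for [Q]. *)
have [/existsP[i /andP[si /set0Pn[e]]]|/existsPn noQ] :=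
    boolP [exists i, (i \in s) && (Q :&: C i != set0)]; last first.
  have : #|s| <= f (\bigcup_(i in s) C i).
    by apply: card_le_nullity fN sC sS _ => i si; apply: bigcup_sup.
  have : f Q + f (\bigcup_(i in s) C i) <= f W.
    apply: super_disjoint => //.
      by rewrite subUset QW /=; apply/bigcupsP=> i; exact: CW.
    apply/subsetP=> z /setIP[zQ /bigcupP[i si Ci]].
    have := noQ i; rewrite si /= negbK => /eqP/setP/(_ z).
    by rewrite in_setI zQ Ci inE.
  by nat_lia.
move=> /setIP[/setIP[euu eA] Ci].
have eW : e \in W by apply: (subsetP QW); rewrite inE euu.
have /unique_unionP[j _ uni] := euu.
have uni' k : k \in t :|: s -> e \in C k -> k = i.
  by move=> tsk Ck; rewrite (uni k) // (uni i) // inE si orbT.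
have sDS : s :\ i \subset S by apply: subset_trans (subD1set _ _) sS.
have := ncycle_lt fN (sys_cyc sC (subsetP sS i si)) (CW i si) Ci => ltW.
move: les fW; rewrite (cardsD1 i s) si ltnS => les fW.
have sub_ts : t :|: s :\ i \subset t :|: s by apply/setUS/subD1set.
have it : i \notin t by apply: contraL si => /(subsetP ts); rewrite inE.
have leW : f (W :\ e) <= #|s :\ i| by nat_lia.
have [||||s' ss' fs'] := IHn (s :\ i) (W :\ e) les sDS _ _ leW.
- by apply: subset_trans ts _; rewrite setCS subD1set.
- exact: subset_trans (subD1set _ _) sWA.
- move=> k; rewrite !inE => /andP[ki sk]; rewrite subsetD1 CW //=.
  by apply: contra ki => Ck; rewrite (uni' k) // inE sk orbT.
(* Dropping [i] creates new uniquely covered elements only inside [C i], hence inside [W], while [e]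
   is no longer covered at all. *)
- apply/subsetP=> z /setIP[/unique_unionP[k /andP[tsk Ck] unik] zA].
  rewrite !inE; apply/andP; split.
    apply/eqP=> ze; rewrite ze in Ck; move: (tsk).
    by rewrite (uni' k (subsetP sub_ts k tsk) Ck) !inE eqxx (negbTE it).
  have [zi|zi] := boolP (z \in C i); first exact: (subsetP (CW i si)).
  apply: (subsetP QW); rewrite inE zA andbT; apply: (mem_unique_union (i := k)) => //.
    exact: (subsetP sub_ts).
  move=> l tsl Cl; apply: unik => //; move: tsl; rewrite !inE.
  by case: eqP => [li|//]; rewrite -li Cl in zi.
by exists s' => //; apply: subset_trans ss' (subD1set _ _).
Qed.

(** The nullity drops by exactly one, as [e] lies in the cycle [C i], and the other members avoid
    [e]. *)
Lemma sysD1 f E S C i e : nullity_fun f -> nullity_system f E S C -> i \in S -> e \in C i ->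
  (forall j, j \in S -> e \in C j -> j = i) -> nullity_system f (E :\ e) (S :\ i) C.
Proof.
move=> fN sC iS Ci uni; have [cS CE cC dC] := sC.
have sSS : S :\ i \subset S by apply: subD1set.
split.
- have := ncycle_lt fN (cC i iS) (CE i iS) Ci; have := nulD1 fN e E.
  by move: cS; rewrite (cardsD1 i S) iS; nat_lia.
- move=> j; rewrite !inE => /andP[ji jS]; rewrite subsetD1 CE //=.
  by apply: contra ji => Cj; rewrite (uni j).
- by move=> j /(subsetP sSS); apply: cC.
by move=> s /subset_trans/(_ sSS); apply: dC.
Qed.

(** Contracting a nonloop preserves the total nullity, and restoring [e] to a trimmed unique union
    gives a superset of the original one. *)
Lemma sys_contr f E S C e : nullity_fun f -> nullity_system f E S C -> e \in E ->
  f [set e] = 0 -> nullity_system (contr f e) (E :\ e) S (fun i => C i :\ e).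
Proof.
move=> fN [cS CE cC dC] eE fe; split.
- by rewrite /contr setD1K // fe subn0.
- by move=> i iS; apply: setSD; apply: CE.
- by move=> i iS; apply: ncycle_contr => //; apply: cC.
move=> s sS s0; rewrite unique_unionD /contr fe subn0.
apply: leq_trans (dC s sS s0) _; apply: nulS => //; set_sub.
Qed.

(** Tightness allows burning all of [A]. It yields members inside [A] whose addition to [s] makes
    the unique union independent on [A]; being dependent, this union has positive nullity outside
    [A], where the added members contribute nothing. *)
Lemma sys_sep f E S C A : nullity_fun f -> nullity_system f E S C -> nsep f E A ->
  tight f S C A -> nullity_system f (E :\: A) (S :\: inside S C A) (fun i => C i :\: A).
Proof.
move=> fN sC sA tA; have [cS CE cC dC] := sC; have /andP[sAE _] := sA.
have inS : inside S C A \subset S by apply/subsetP=> i; rewrite inE => /andP[].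
split.
- by rewrite cardsD (setIidPr inS) cS tA (nsepE fN sA) addKn.
- by move=> i; rewrite in_setD => /andP[_ iS]; apply: setSD; apply: CE.
- move=> i; rewrite in_setD => /andP[_ iS].
  exact: (ncycleD fN sA (cC i iS) (CE i iS)).
move=> s sS s0; rewrite unique_unionD.
have ts : s \subset ~: inside S C A.
  by apply: subset_trans sS _; rewrite setDE subsetIr.
have CA i : i \in inside S C A -> C i \subset A by rewrite inE => /andP[].
have fA : f A <= #|inside S C A| by rewrite tA.
have [s' ss' fs'] := burn fN sC inS ts (subxx A) fA CA (subsetIr _ _).
have sUS : s :|: s' \subset S.
  by rewrite subUset (subset_trans sS (subsetDl _ _)) (subset_trans ss' inS).
have sU0 : s :|: s' != set0.
  by apply: contraNneq s0 => /eqP; rewrite setU_eq0 => /andP[].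
have := dC _ sUS sU0.
have uuE : unique_union C (s :|: s') \subset E.
  apply/subsetP=> z /unique_union_cover[i /(subsetP sUS) iS]; exact: (subsetP (CE i iS)).
rewrite (nsep_split fN sA uuE) fs' add0n => /leq_trans; apply; apply: nulS => //.
apply/subsetP=> z; rewrite !in_setD => /andP[zA /unique_unionP[i /andP[ssi Ci] uni]].
have notin j : j \in s' -> z \notin C j.
  move=> js'; apply: contra zA; apply: (subsetP (CA j _)); exact: (subsetP ss').
rewrite zA; apply: (mem_unique_union (i := i)) => //.
  by move: ssi; rewrite inE => /orP[//|/notin]; rewrite Ci.
by move=> j sj; apply: uni; rewrite inE sj.
Qed.

End System.

(** * Existence of a tight component *)

Section TightComponent.
Variables (T : finType) (g : nat).
Implicit Types (f : {set T} -> nat) (A B E K W X Y : {set T}) (e x y : T).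
Implicit Types (S s t : {set 'I_g}) (C : 'I_g -> {set T}).

Lemma nsep_refl f E : nsep f E E.
Proof. by rewrite /nsep subxx leq_addr. Qed.

Lemma nconn1 f e : nconn f [set e].
Proof. by apply/forallP=> X; apply/implyP=> /andP[]; rewrite subset1 orbC. Qed.

Lemma insideP S C A i : reflect (i \in S /\ C i \subset A) (i \in inside S C A).
Proof. by rewrite inE; apply: andP. Qed.

Lemma sys_gt0 f E S C i : nullity_fun f -> nullity_system f E S C -> i \in S -> 0 < f (C i).
Proof.
move=> fN sC iS; have := sys_dep sC (s := [set i]); rewrite sub1set iS -cards_eq0 cards1.
move=> /(_ isT isT)/leq_trans; apply; apply: nulS => //.
by apply/subsetP=> z /unique_union_cover[j /set1P->].
Qed.

Lemma inside_le f E S C A : nullity_fun f -> nullity_system f E S C -> #|inside S C A| <= f A.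
Proof.
move=> fN sC; apply: card_le_nullity fN sC _ _; first by apply/subsetP=> i /insideP[].
by move=> i /insideP[].
Qed.

Lemma nsep_contr f e E A : f [set e] = 0 ->
  nsep (contr f e) E A =
    (A \subset E) && (f (e |: E) <= f (e |: A) + f (e |: (E :\: A))).
Proof. by rewrite /nsep /contr => ->; rewrite !subn0. Qed.

(** Here [e] is a coloop of [e |: A], so a separation of [A] remains one after contraction. *)
Lemma component_contr f E A e : nullity_fun f -> f [set e] = 0 -> e \in E ->
  component (contr f e) (E :\ e) A -> f (e |: A) <= f A -> component f E A.
Proof.
move=> fN fe eE [A0]; rewrite nsep_contr // setD1K // => /andP[sAE sepA] cA leA.
have eA : e \notin A by apply/negP=> /(subsetP sAE); rewrite !inE eqxx.
have s1 : e |: (E :\ e :\: A) \subset E :\: A by set_sub.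
have s2 : A \subset E by set_sub.
split=> //; first by rewrite /nsep s2 /=; have := nulS fN s1; nat_lia.
apply/forallP=> X; apply/implyP=> /andP[sXA sepX].
have /forallP/(_ X)/implyP := cA; apply; rewrite nsep_contr // sXA /=.
have := nulS fN (subsetUr [set e] X); have := nulS fN (subsetUr [set e] (A :\: X)).
nat_lia.
Qed.

(** Here [e] depends on [A] but is a coloop of [E :\: A]. A separator containing [e] induces one of
    [A] in the contraction, which is [A] or empty; the empty case contradicts the dependence on [A].
    A separator missing [e] is handled through its complement. *)
Lemma component_contrU1 f E A e : nullity_fun f -> f [set e] = 0 -> e \in E ->
  component (contr f e) (E :\ e) A -> f A < f (e |: A) ->
  f (E :\: A) <= f (E :\: A :\ e) -> component f E (e |: A).
Proof.
move=> fN fe eE [A0]; rewrite nsep_contr // setD1K // => /andP[sAE sepA] cA ltA leB.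
have eA : e \notin A by apply/negP=> /(subsetP sAE); rewrite !inE eqxx.
have s2 : e |: A \subset E by set_sub.
split.
- by apply/set0Pn; exists e; rewrite setU11.
- have s1 : e |: (E :\ e :\: A) \subset E :\: A by set_sub.
  have s3 : E :\: A :\ e \subset E :\: (e |: A) by set_sub.
  by rewrite /nsep s2 /=; have := nulS fN s1; have := nulS fN s3; nat_lia.
have key X : nsep f (e |: A) X -> e \in X -> X = e |: A.
  move=> /andP[sX sepX] eX.
  have sXA : X :\ e \subset A by set_sub.
  have sc : nsep (contr f e) A (X :\ e).
    rewrite nsep_contr // sXA setD1K //=.
    have s3 : (e |: A) :\: X \subset e |: (A :\: (X :\ e)) by set_sub.
    by have := nulS fN s3; nat_lia.
  have [X0|<-] := nconnP cA sc; last by rewrite setD1K.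
  have eqX : X = [set e] by rewrite -(setD1K eX) X0 setU0.
  by move: sepX; rewrite eqX setU1K // fe; nat_lia.
apply/forallP=> X; apply/implyP=> sX; have /andP[sXA _] := sX.
have [eX|eX] := boolP (e \in X); first by rewrite (key X) // eqxx orbT.
have := key _ (nsepC sX); rewrite !inE eqxx eX => /(_ isT)/setP eqX.
apply/orP; left; apply/eqP/setP=> z; have := eqX z.
rewrite !in_setD in_set0; have := subsetP sXA z.
by case: (z \in X) => //= ->.
Qed.

Lemma inside_D1 S C A i e : e \in C i -> e \notin A -> inside (S :\ i) C A = inside S C A.
Proof.
move=> Ci eA; apply/setP=> j; rewrite !inE; case: eqP => //= ->.
by apply/esym/negP=> /andP[_ /subsetP/(_ e Ci)]; rewrite (negbTE eA).
Qed.

Lemma nsep_loop f E e : nullity_fun f -> 0 < f [set e] -> e \in E -> nsep f E [set e].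
Proof.
move=> fN loop eE.
by rewrite /nsep sub1set eE (leq_trans (nulD1 fN e E)) // -add1n leq_add2r.
Qed.

(** The circuit claim is carried through the induction because it makes [C i] connected, which
    places [C i] inside the component of [e]. *)
Lemma tight_component f E S C : nullity_fun f -> nullity_system f E S C -> E != set0 ->
  exists A, [/\ component f E A, tight f S C A &
                forall i, i \in inside S C A -> f (C i) = 1].
Proof.
have [n] := ubnP #|E|; elim: n => // n IHn in f E S C * => leE fN sC E0.
have [S0|S0] := eqVneq S set0.
  have /set0Pn[x xE] := E0; have [A cA _] := component_at fN xE.
  have i0 : inside S C A = set0 by apply/setP=> i; rewrite S0 !inE.
  exists A; split=> //; last by move=> i; rewrite i0 inE.
  rewrite /tight i0 cards0; apply/esym/eqP; rewrite -leqn0.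
  have [_ /andP[sAE _] _] := cA; have := nulS fN sAE.
  by rewrite -(sys_card sC) S0 cards0.
have [e [i [iS Ci _ uni]]] := sys_dep_ex fN sC (subxx S) S0.
have eE := subsetP (sys_sub sC iS) e Ci.
have cCi := sys_cyc sC iS.
have ltE : #|E :\ e| < n by move: leE; rewrite (cardsD1 e E) eE.
have sD := sysD1 fN sC iS Ci uni.
(* For a single element the minors have empty ground set, outside the scope of the induction
   hypothesis. *)
have [Ee0|Ee0] := eqVneq (E :\ e) set0.
  have eqE : E = [set e] by rewrite -(setD1K eE) Ee0 setU0.
  exists E; split; first by split; rewrite ?nsep_refl // eqE nconn1.
    rewrite /tight -(sys_card sC); apply: eq_card => j; rewrite inE.
    by have [/(sys_sub sC)->|] := boolP (j \in S).
  move=> j /insideP[jS sCj]; apply/eqP; rewrite eqn_leq (sys_gt0 fN sC jS) andbT.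
  by apply: leq_trans (nulS fN sCj) _; have := nulD1 fN e E; rewrite Ee0 (nul0 fN).
have [A' [cA' tA' circA']] := IHn _ _ _ _ ltE fN sD Ee0.
have [A'0 sepA' conA'] := cA'; have /andP[sA'E _] := sepA'.
have eA' : e \notin A' by apply/negP=> /(subsetP sA'E); rewrite !inE eqxx.
have eqin : inside (S :\ i) C A' = inside S C A' by apply: inside_D1 Ci eA'.
rewrite /tight eqin in tA' circA'.
(* The members inside [A'] are the same for both systems, since [C i] contains [e]; only separation
   in [E] remains to be checked. *)
have A'done : nsep f E A' -> exists A, [/\ component f E A, tight f S C A &
                forall i, i \in inside S C A -> f (C i) = 1].
  by move=> sep; exists A'.
have [fe|loop] := posnP (f [set e]); last first.
  apply: A'done; apply: (nsep_trans fN _ sepA').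
  exact/nsepC/(nsep_loop fN loop eE).
have [B [cB tB circB]] := IHn _ _ _ _ ltE (contr_nullity fN e) (sys_contr fN sC eE fe) Ee0.
set S' := inside _ _ _ in tB circB.
have [B0 sepB conB] := cB; have /andP[sBE _] := sepB.
have eB : e \notin B by apply/negP=> /(subsetP sBE); rewrite !inE eqxx.
rewrite /tight /contr fe subn0 -/S' in tB.
have circS' j : j \in S' -> f (C j) = 1.
  move=> jS'; have := circB j jS'; rewrite /contr fe subn0 => fCj.
  have /insideP[jS _] := jS'.
  apply/eqP; rewrite eqn_leq (sys_gt0 fN sC jS) andbT -fCj; apply: nulS => //.
  by set_sub.
have [iS'|iS'] := boolP (i \in S'); last first.
  have eqS' : inside S C B = S'.
    apply/setP=> j; apply/insideP/insideP=> [[jS sCj]|[jS sCj]]; split=> //.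
      exact: subset_trans (subD1set _ _) sCj.
    suff eCj : e \notin C j by rewrite (setDidPl _) // disjoint_sym disjoints1 in sCj.
    apply: contra iS' => eCj; rewrite -(uni j jS eCj); exact/insideP.
  (* Tightness in the contraction counts [f (e |: B)] members inside [B], but there are at most
     [f B]; hence [e] is a coloop of [e |: B]. *)
  have leB : f (e |: B) <= f B by rewrite -tB -eqS'; apply: inside_le fN sC.
  exists B; split; first exact: component_contr cB leB.
    by rewrite /tight eqS' tB; apply/eqP; rewrite eqn_leq leB nulS // subsetUr.
  by rewrite eqS'.
have /insideP[_ sCiB] := iS'.
have sCB : C i \subset e |: B by rewrite -subDset; exact: sCiB.
have ltB : f B < f (e |: B) by have := ncycle_lt fN cCi sCB Ci; rewrite setU1K.
have eqSB : inside S C (e |: B) = S'.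
  by apply/setP=> j; rewrite !inE subDset.
(* If [e] is a coloop of [E :\: B], then [e |: B] is a component, and it contains exactly the
   members whose traces lie in [B]. *)
have [leB|ltB'] := leqP (f (E :\: B)) (f (E :\: B :\ e)).
  exists (e |: B); split; first exact: component_contrU1 cB ltB leB.
    by rewrite /tight eqSB.
  by rewrite eqSB.
have [A cA eA] := component_at fN eE; have [A0 sepA conA] := cA.
have /andP[sAE _] := sepA.
have conCi : nconn f (C i) by apply: circuit_nconn => //; apply: circS'.
have sCiA : C i \subset A by apply: nconn_sub sepA conCi (sys_sub sC iS) Ci eA.
have sAeE : A :\ e \subset E :\ e by apply: setSD.
have sepAe : nsep f (E :\ e) (A :\ e).
  have := nsepI fN sepA (subD1set E e); congr (nsep f _ _).
  by apply/setP=> z; rewrite !inE; case: eqP => //= _; apply/andb_idl/(subsetP sAE).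
(* When [A'] misses the component of [e], the cycle [C i] lies in [E :\: A'], so putting [e] back
   raises the nullity of the complement and [A'] stays a separator. *)
have [disj|[x /setIP[xA' xA]]] := set_0Vmem (A' :&: A).
  apply: A'done.
  have s1 : A' \subset E by set_sub.
  have sCi' : C i \subset E :\: A'.
    apply/subsetP=> z zC; rewrite inE (subsetP (sys_sub sC iS)) // andbT.
    have /setP/(_ z) := disj; rewrite !inE (subsetP sCiA) // andbT => ->.
    by [].
  have := ncycle_lt fN cCi sCi' Ci; have := nsepE fN sepA'; have := nulD1 fN e E.
  rewrite setDDl setUC -setDDl /nsep s1 /=; nat_lia.
have xe : x != e by apply: contraNneq eA' => <-.
have sA'A : A' \subset A :\ e.
  by apply: nconn_sub sepAe conA' sA'E xA' _ => //; rewrite !inE xe.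
have conAe : nconn f (A :\ e).
  (* Were [A :\ e] connected in the contraction, it would be the component [B], making [e] a coloop
     of [E :\: B] against [ltB']. *)
  have [//|conAe] := tutte fN conA eA.
  have sepcA : nsep (contr f e) (E :\ e) (A :\ e).
    rewrite nsep_contr // sAeE !setD1K //=.
    have s : E :\: A \subset e |: (E :\ e :\: (A :\ e)) by set_sub.
    by have := nulS fN s; have /andP[_] := sepA; nat_lia.
  have [y yC] : exists y, y \in C i :\ e.
    apply/set0Pn/negP=> /eqP Ci0; have := sys_gt0 fN sC iS.
    by rewrite -(setD1K Ci) Ci0 setU0 fe.
  have yB : y \in B by apply: (subsetP sCiB).
  have yA : y \in A :\ e by apply: (subsetP (setSD _ sCiA)).
  have cN := contr_nullity fN e.
  have eqBA : B = A :\ e.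
    apply/eqP; rewrite eqEsubset (nconn_sub cN sepcA conB sBE yB yA).
    by rewrite (nconn_sub cN sepB conAe sAeE yA yB).
  have s3 : E :\: A \subset E :\: B :\ e by rewrite eqBA; set_sub.
  have u : A :|: (E :\: B) \subset E by rewrite eqBA; set_sub.
  have ii : A :&: (E :\: B) \subset [set e] by rewrite eqBA; set_sub.
  by have := super_sub fN u ii; have := nulS fN s3; have := nsepE fN sepA; nat_lia.
have eqA' : A' = A :\ e.
  apply/eqP; rewrite eqEsubset sA'A.
  by apply: (nconn_sub fN sepA' conAe sAeE _ xA'); rewrite !inE xe.
have inA j : j \in inside S C A -> j = i \/ j \in inside S C A'.
  move=> /insideP[jS sCj]; have [|ji] := eqVneq j i; [by left | right].
  apply/insideP; split=> //; rewrite eqA' subsetD1 sCj /=.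
  by apply: contra ji => Cj; rewrite (uni j).
exists A; split=> //; last by move=> j /inA[->|/circA']; first exact: circS'.
rewrite /tight; apply/eqP; rewrite eqn_leq (inside_le _ fN sC) /=.
(* Adding [e] to [A'] raises the nullity by at most one, which the additional member [i] accounts
   for. *)
apply: leq_trans (nulD1 fN e A) _; rewrite -eqA' -tA'.
have iA' : i \notin inside S C A' by apply/insideP=> -[_ /subsetP/(_ e Ci)]; apply/negP.
have <- : #|i |: inside S C A'| = #|inside S C A'|.+1 by rewrite cardsU1 iA'.
apply/subset_leq_card/subsetP=> j; rewrite in_setU1 => /predU1P[->|/insideP[jS sCj]].
  exact/insideP.
by apply/insideP; split=> //; rewrite (subset_trans sCj) // eqA' subD1set.
Qed.

End TightComponent.

(** * Iterated removal of tight components *)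

Section Iteration.
Variables (T : finType) (g : nat).
Implicit Types (f : {set T} -> nat) (A B E K W X Y : {set T}) (e x y : T).
Implicit Types (S s t : {set 'I_g}) (C : 'I_g -> {set T}).

(* [a l] is the position in [r] of the last component met by [C l]. *)
Record decomp f E S C (r : seq {set T}) (a : 'I_g -> nat) : Prop := Decomp {
  dec_comp : forall A, A \in r -> component f E A;
  dec_disj : forall i j, i < j < size r -> nth set0 r i :&: nth set0 r j = set0;
  dec_cover : E = \bigcup_(A <- r) A;
  dec_sum : forall X, X \subset E -> f X = \sum_(A <- r) f (X :&: A);
  dec_size : forall l, l \in S -> a l < size r;
  dec_sub : forall l, l \in S -> C l \subset \bigcup_(A <- take (a l).+1 r) A;
  dec_cyc : forall l, l \in S ->
    ncycle f (C l :&: nth set0 r (a l)) /\ f (C l :&: nth set0 r (a l)) = 1;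
  dec_card : forall i, i < size r -> #|[set l in S | a l == i]| = f (nth set0 r i);
  dec_uu : forall i s, s \subset S -> (forall l, l \in s -> a l = i) -> s != set0 ->
    0 < f (unique_union (fun l => C l :&: nth set0 r i) s)
}.

Lemma component_sub f E A : component f E A -> A \subset E.
Proof. by case=> _ /andP[]. Qed.

(** A tight component [A] is split off and the traces on [E :\: A] are decomposed by induction;
    components of the separator [E :\: A] are components of [E]. *)
Lemma decomp_exists f E S C : nullity_fun f -> nullity_system f E S C ->
  exists r a, decomp f E S C r a.
Proof.
have [n] := ubnP #|E|; elim: n => // n IHn in E S C * => leE fN sC.
have [E0|E0] := eqVneq E set0.
  have S0 : S = set0.
    by apply/eqP; rewrite -cards_eq0 (sys_card sC) E0 (nul0 fN).
  exists [::], (fun=> 0); split=> //.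
  - by move=> i j; rewrite ltn0 andbF.
  - by rewrite E0 big_nil.
  - by move=> X; rewrite E0 subset0 => /eqP->; rewrite big_nil (nul0 fN).
  - by move=> l; rewrite S0 inE.
  - by move=> l; rewrite S0 inE.
  - by move=> l; rewrite S0 inE.
  by move=> i s; rewrite S0 subset0 => /eqP->; rewrite eqxx.
have [A [cA tA circA]] := tight_component fN sC E0.
have [A0 sepA conA] := cA; have sAE := component_sub cA.
have sC' := sys_sep fN sC sepA tA.
have ltE : #|E :\: A| < n.
  have /card_gt0P/(leq_trans _) : exists x, x \in A by apply/set0Pn.
  move: leE; rewrite cardsD (setIidPr sAE); have := subset_leq_card sAE.
  have : 0 < #|A| by rewrite card_gt0.
  nat_lia.
have [r [a dec]] := IHn _ _ _ ltE fN sC'.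
rewrite /tight in tA; set t := inside S C A in sC' dec tA circA.
have tP l : l \in t -> l \in S /\ C l \subset A by move/insideP.
clearbody t.
have rA B : B \in r -> B \subset E :\: A by move/(dec_comp dec)/component_sub.
have nthA i : nth set0 r i \subset E :\: A.
  have [ltir|lerr] := ltnP i (size r); first exact/rA/mem_nth.
  by rewrite nth_default // sub0set.
have DI X B : B \subset E :\: A -> (X :\: A) :&: B = X :&: B.
  move=> sB; apply/setP=> z; rewrite !inE; have := subsetP sB z; rewrite inE.
  by case: (z \in B) => [/(_ isT)/andP[->]|]; rewrite ?andbF.
(* Members inside [A] get position 0. The others may also meet [A], but their last component comes
   from [r], one place later. *)
exists (A :: r), (fun l => if l \in t then 0 else (a l).+1); split.
- move=> B; rewrite inE => /predU1P[->//|/(dec_comp dec)[B0 sepB conB]].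
  by split=> //; apply: (nsep_trans fN (nsepC sepA)).
- case=> [|i] [|j] //=; last by rewrite !ltnS; apply: (dec_disj dec).
  move=> _; apply/eqP; rewrite -subset0.
  have := nthA j; set B := nth _ _ _ => sB; set_sub.
- rewrite big_cons -(dec_cover dec); apply/setP=> z; rewrite !inE.
  by have := subsetP sAE z; case: (z \in A) => // ->.
- move=> X sX; rewrite big_cons (nsep_split fN sepA sX); congr (_ + _).
  rewrite (dec_sum dec) ?setSD //.
  by apply: eq_big_seq => B /rA sB; rewrite DI.
- move=> l lS; case: ifPn => // lt; rewrite ltnS; apply: (dec_size dec).
  by rewrite inE lt.
- move=> l lS; case: ifPn => [/tP[_ sCA]|lt]; first by rewrite /= take0 big_seq1.
  rewrite /= big_cons -subDset; apply: (dec_sub dec).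
  by rewrite inE lt.
- move=> l lS; case: ifPn => [lt|lt] /=.
    have [_ /setIidPl->] := tP l lt; split; last exact: circA.
    exact: (sys_cyc sC).
  by rewrite -(DI (C l)) //; apply: (dec_cyc dec); rewrite inE lt.
- case=> [_|i] /=.
    rewrite -tA; apply: eq_card => l; rewrite inE.
    by have [lt|lt] := boolP (l \in t); rewrite ?andbF //; have [->] := tP l lt.
  rewrite ltnS => /(dec_card dec) <-; apply: eq_card => l; rewrite !in_set.
  by have [lt|lt] := boolP (l \in t); rewrite ?eqSS ?andbF.
case=> [|i] s sS sa s0 /=.
  have sA l : l \in s -> C l \subset A.
    by move=> ls; have := sa l ls; case: ifP => // /tP[].
  rewrite (@eq_unique_union _ _ _ C); first exact: (sys_dep sC sS s0).
  by move=> l /sA/setIidPl.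
have sD l : l \in s -> l \notin t by move/sa; case: ifP.
have -> : unique_union (fun l => C l :&: nth set0 r i) s =
          unique_union (fun l => (C l :\: A) :&: nth set0 r i) s.
  by apply: eq_unique_union => l _; rewrite DI.
apply: (dec_uu dec) => //.
  by apply/subsetP=> l ls; rewrite inE sD // (subsetP sS).
by move=> l ls; have := sa l ls; rewrite (negbTE (sD l ls)) => -[].
Qed.

End Iteration.

(** * The nullity of a matroid *)

Section Bridge.
Variable T : finType.
Implicit Types (M : matroid T) (A B E D I J K W X Y : {set T}) (e x y : T).

Definition rk M X : nat := rank (restrict M X).
(** Elements outside the ground set count as loops, so the axioms of [nullity_fun] hold for all
    sets. *)
Definition nullity M X : nat := #|X| - rk M X.

Lemma rk_ge M X I : indep M I -> I \subset X -> #|I| <= rk M X.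
Proof.
move=> iI sIX; apply: (leq_bigmax_cond (F := fun I : {set T} => #|I|)).
exact/andP.
Qed.

Lemma rk_basis M X : exists I, [/\ indep M I, I \subset X & #|I| = rk M X].
Proof.
rewrite /rk /rank; have i0 : indep (restrict M X) set0 by apply: indep0.
have [I /andP[iI sIX] ->] := eq_bigmax_cond (fun I : {set T} => #|I|)
  (introT card_gt0P (ex_intro _ set0 i0)).
by exists I.
Qed.

Lemma rk_le_card M X : rk M X <= #|X|.
Proof. by have [I [_ /subset_leq_card sIX <-]] := rk_basis M X. Qed.

Lemma indep_extend M X I : indep M I -> I \subset X ->
  exists J, [/\ indep M J, I \subset J, J \subset X & #|J| = rk M X].
Proof.
move=> iI sIX.
pose P := [pred J : {set T} | [&& indep M J, I \subset J & J \subset X]].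
have [J maxJ _] := maxset_exists (P := P) (introT and3P (And3 iI (subxx I) sIX)).
have /maxsetP[/and3P[iJ sIJ sJX] mJ] := maxJ.
exists J; split=> //; apply/eqP; rewrite eqn_leq rk_ge //= leqNgt.
have [B [iB sBX <-]] := rk_basis M X.
apply/negP=> ltJB; have [x] := indep_aug iJ iB ltJB.
rewrite inE => /andP[xJ xB] ixJ.
suff : x \in J by apply/negP.
rewrite -(mJ (x |: J)) ?setU11 ?subsetU1 //.
by rewrite /P /= ixJ (subset_trans sIJ) ?subsetU1 //= subUset sub1set (subsetP sBX) ?sJX.
Qed.

Lemma rkS M X Y : X \subset Y -> rk M X <= rk M Y.
Proof.
move=> sXY; have [I [iI sIX <-]] := rk_basis M X.
exact: rk_ge iI (subset_trans sIX sXY).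
Qed.

(** A basis [I] of [X :&: Y] is extended to a basis [J] of [X :|: Y]; the traces of [J] on [X] and
    [Y] are independent and both contain [I]. *)
Lemma rk_submod M X Y : rk M (X :|: Y) + rk M (X :&: Y) <= rk M X + rk M Y.
Proof.
have [I [iI sI <-]] := rk_basis M (X :&: Y).
have [|J [iJ sIJ sJ <-]] := @indep_extend M (X :|: Y) I iI.
  by apply: subset_trans sI _; set_sub.
have leX : #|J :&: X| <= rk M X.
  by apply: rk_ge; rewrite ?subsetIr // (indepS (subsetIl _ _) iJ).
have leY : #|J :&: Y| <= rk M Y.
  by apply: rk_ge; rewrite ?subsetIr // (indepS (subsetIl _ _) iJ).
have leI : #|I| <= #|(J :&: X) :&: (J :&: Y)|.
  by apply: subset_leq_card; rewrite -setIIr subsetI sIJ sI.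
have := cardsUI (J :&: X) (J :&: Y); rewrite -setIUr (setIidPl sJ).
nat_lia.
Qed.

Lemma nullity_rk M X : nullity M X + rk M X = #|X|.
Proof. exact: subnK (rk_le_card M X). Qed.

Lemma nullityP M : nullity_fun (nullity M).
Proof.
split.
- by rewrite /nullity cards0.
- move=> X Y sXY; have := nullity_rk M X; have := nullity_rk M Y.
  have [J [iJ sJ Jrk]] := rk_basis M Y.
  have leX : #|J :&: X| <= rk M X.
    by apply: rk_ge; rewrite ?subsetIr // (indepS (subsetIl _ _) iJ).
  have := subset_leq_card (setSD X sJ); rewrite [#|Y :\: X|]cardsD (setIidPr sXY).
  have := cardsID X J; have := subset_leq_card sXY; nat_lia.
- move=> e X; have := nullity_rk M X; have := nullity_rk M (e |: X).
  have := rkS M (subsetUr [set e] X); rewrite cardsU1.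
  by case: (e \in X); nat_lia.
move=> X Y; have := rk_submod M X Y; have := cardsUI X Y.
have := nullity_rk M X; have := nullity_rk M Y.
have := nullity_rk M (X :|: Y); have := nullity_rk M (X :&: Y); nat_lia.
Qed.

Lemma indep_nullity M X : indep M X = (nullity M X == 0).
Proof.
apply/idP/eqP=> [iX|n0].
  by have := rk_ge iX (subxx X); rewrite /nullity -subn_eq0 => /eqP.
have [I [iI sIX Irk]] := rk_basis M X.
suff <- : I = X by [].
by apply/eqP; rewrite eqEcard sIX -(nullity_rk M X) n0 Irk leqnn.
Qed.

Lemma dependent_nullity M D : dependent M D = (D \subset ground M) && (0 < nullity M D).
Proof. by rewrite /dependent indep_nullity lt0n. Qed.

(** Minimality makes every [K :\ x] independent, and unit increments then bound the nullity by 1.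
    Conversely, a proper subset lies in some [K :\ x], of nullity 0. *)
Lemma circuitP M K :
  reflect [/\ K \subset ground M, ncycle (nullity M) K & nullity M K = 1] (circuit M K).
Proof.
have fN := nullityP M.
apply: (iffP minsetP) => [[dK minK]|[sK cK K1]].
  move: dK; rewrite dependent_nullity => /andP[sK Kgt0].
  have K0 x : x \in K -> nullity M (K :\ x) = 0.
    move=> xK; apply/eqP; rewrite -leqn0 leqNgt; apply/negP=> Kx.
    have := minK (K :\ x); rewrite dependent_nullity Kx subD1set.
    rewrite (subset_trans (subD1set _ _) sK) => /(_ isT isT)/setP/(_ x).
    by rewrite !inE eqxx xK.
  have /set0Pn[x xK] : K != set0 by apply: contraTneq Kgt0 => ->; rewrite (nul0 fN).
  split=> [//|z /K0->//|]; apply/eqP; rewrite eqn_leq Kgt0 andbT.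
  by apply: leq_trans (nulD1 fN x K) _; rewrite K0.
split=> [|D]; first by rewrite dependent_nullity sK K1.
rewrite dependent_nullity => /andP[sD D1] sDK; apply/eqP; rewrite eqEsubset sDK.
apply/subsetP=> x xK; apply/negPn/negP=> xD.
have s : D \subset K :\ x by set_sub.
by have := nulS fN s; have := cK x xK; rewrite K1; nat_lia.
Qed.

(** If removing [x] lowers the nullity, a basis [I] of [K :\ x] spans [x], so [x |: I] contains a
    circuit, and this circuit passes through [x]. Conversely, a circuit through [x] inside [K]
    forces the drop. *)
Lemma matroid_cycleP M K :
  reflect (K \subset ground M /\ ncycle (nullity M) K) (matroid_cycle M K).
Proof.
have fN := nullityP M.
apply: (iffP existsP) => [[Q /andP[/forallP cQ /eqP->]]|[sK cK]].
  have cirQ D : D \in Q -> circuit M D by move=> DQ; have := cQ D; rewrite DQ.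
  split; first by apply/bigcupsP=> D /cirQ/circuitP[].
  move=> x /bigcupP[D DQ xD]; have /circuitP[_ cD _] := cirQ D DQ.
  apply: ncycle_lt cD _ xD => //; exact: bigcup_sup.
exists [set D : {set T} | circuit M D && (D \subset K)].
apply/andP; split; first by apply/forallP=> D; rewrite inE; apply/implyP=> /andP[].
rewrite eqEsubset; apply/andP; split; last first.
  by apply/bigcupsP=> D; rewrite inE => /andP[].
apply/subsetP=> x xK.
have [I [iI sI Irk]] := rk_basis M (K :\ x).
have dxI : dependent M (x |: I).
  rewrite /dependent subUset sub1set (subsetP sK) // (indep_ground iI) /=.
  apply/negP=> ixI.
  have xI : x \notin I by apply/negP=> /(subsetP sI); rewrite !inE eqxx.
  have sxI : x |: I \subset K by set_sub.
  have := rk_ge ixI sxI; rewrite cardsU1 xI Irk.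
  have := cK x xK; have := nullity_rk M (K :\ x); have := nullity_rk M K.
  rewrite (cardsD1 x K) xK; nat_lia.
have [D mD sD] := minset_exists dxI.
have xD : x \in D.
  apply/negPn/negP=> xD; have sDI : D \subset I by set_sub.
  have /minsetP[/andP[_ /negP nD] _] := mD; apply: nD; exact: indepS sDI iI.
apply/bigcupP; exists D => //; rewrite inE; apply/andP; split; first exact: mD.
by apply: subset_trans sD _; set_sub.
Qed.

Lemma nullity_restrict M A X : X \subset A -> nullity (restrict M A) X = nullity M X.
Proof.
move=> sXA; rewrite /nullity /rk /rank; congr (_ - _); apply: eq_bigl => I /=.
rewrite /restrict_indep /= /restrict_indep /=.
by case: (boolP (I \subset X)) => [sIX|]; rewrite ?andbF // (subset_trans sIX sXA) !andbT.
Qed.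

Lemma corank_nullity M : corank M = nullity M (ground M).
Proof.
rewrite /corank /nullity /rk /rank; congr (_ - _); apply: eq_bigl => I /=.
rewrite /restrict_indep /=; exact/esym/andb_idr/indep_ground.
Qed.

(** For a nonloop, bases of [X] in the contraction extend by [e] to bases of [e |: X]. For a loop,
    the subtracted [nullity M [set e] = 1] cancels the unit added by [e]. *)
Lemma nullity_contract M e X : e \in ground M -> X \subset ground M :\ e ->
  nullity (contract M e) X = contr (nullity M) e X.
Proof.
move=> eE sX; have eX : e \notin X by apply/negP=> /(subsetP sX); rewrite !inE eqxx.
have fN := nullityP M.
have [ie|de] := boolP (indep M [set e]).
  rewrite /contr; have /eqP-> : nullity M [set e] == 0 by rewrite -indep_nullity.
  suff : (rk (contract M e) X).+1 = rk M (e |: X).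
    have := nullity_rk (contract M e) X; have := nullity_rk M (e |: X).
    by rewrite cardsU1 eX subn0; nat_lia.
  apply/eqP; rewrite eqn_leq; apply/andP; split.
    have [I [/andP[eI]]] := rk_basis (contract M e) X.
    rewrite ie => iI sI <-; rewrite -[_.+1]/(1 + _)%N.
    have -> : 1 + #|I| = #|e |: I| by rewrite cardsU1 eI.
    by apply: rk_ge iI _; apply: setUS.
  have [|J [iJ sJ sJX <-]] := indep_extend (X := e |: X) ie; first by rewrite sub1set setU11.
  rewrite sub1set in sJ; rewrite (cardsD1 e) sJ ltnS; apply: rk_ge.
    by rewrite /= /contract_indep /= !inE eqxx ie setD1K.
  by rewrite subDset.
have fe : nullity M [set e] = 1.
  apply/eqP; rewrite eqn_leq lt0n -indep_nullity de andbT.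
  by have := nulU1 fN e set0; rewrite setU0 (nul0 fN).
have eI I : indep M I -> e \notin I.
  by move=> iI; apply: contra de => eI; apply: indepS iI; rewrite sub1set.
have -> : nullity (contract M e) X = nullity M X.
  rewrite /nullity /rk /rank; congr (_ - _); apply: eq_bigl => I /=.
  rewrite /restrict_indep /= /contract_indep /=.
  by rewrite (negbTE de); congr (_ && _); apply: andb_idl; apply: eI.
rewrite /contr fe; have := nullity_rk M X; have := nullity_rk M (e |: X).
have -> : rk M (e |: X) = rk M X.
  apply/eqP; rewrite eqn_leq (rkS M (subsetUr [set e] X)) andbT.
  have [I [iI sI <-]] := rk_basis M (e |: X); have eNI := eI I iI.
  by apply: rk_ge iI _; set_sub.
by rewrite cardsU1 eX; nat_lia.
Qed.

Lemma eq_nsep f f' E A : (forall X, X \subset E -> f X = f' X) -> nsep f E A = nsep f' E A.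
Proof.
by move=> eqf; rewrite /nsep; case: (boolP (A \subset E)) => //= sA; rewrite !eqf // subsetDl.
Qed.

Lemma eq_nconn f f' E : (forall X, X \subset E -> f X = f' X) -> nconn f E = nconn f' E.
Proof. by move=> eqf; apply: eq_forallb => X; rewrite (eq_nsep _ eqf). Qed.

(** A circuit meeting both sides of a separation is impossible, circuits being connected; the
    converse is [nconn_circuit]. *)
Lemma connected_nconn M : connected M = nconn (nullity M) (ground M).
Proof.
have fN := nullityP M; apply/idP/idP=> [/forallP con|con].
  apply/forallP=> X; apply/implyP=> sX; have /andP[sXE _] := sX.
  have [//|/set0Pn[x xX]] := eqVneq X set0.
  have [//|nX] := eqVneq X (ground M).
  have [y yE yX] : exists2 y, y \in ground M & y \notin X.
    by apply/subsetPn; rewrite eqEsubset sXE in nX.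
  have := con x; rewrite (subsetP sXE) //= => /forallP/(_ y); rewrite yE /=.
  have xy : x != y by apply: contraNneq yX => <-.
  rewrite xy /= => /existsP[D /and3P[/circuitP[sD cD D1] xD yD]].
  have conD := circuit_nconn fN cD D1.
  by have := subsetP (nconn_sub fN sX conD sD xD xX) y yD; rewrite (negbTE yX).
apply/forallP=> x; apply/implyP=> xE; apply/forallP=> y; apply/implyP=> yE.
apply/implyP=> xy; have [D [sD xD yD cD D1]] := nconn_circuit fN con xE yE xy.
by apply/existsP; exists D; rewrite xD yD !andbT; apply/circuitP.
Qed.

Lemma connected_restrict M A : A \subset ground M ->
  connected (restrict M A) = nconn (nullity M) A.
Proof.
move=> sA; rewrite connected_nconn /= (setIidPr sA).
by apply: eq_nconn => X; apply: nullity_restrict.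
Qed.

Lemma component_components M A : component (nullity M) (ground M) A -> A \in components M.
Proof.
have fN := nullityP M.
move=> cA; have [A0 sA conA] := cA; have sAE := component_sub cA.
rewrite inE; apply/maxsetP; split; first by rewrite /= sAE connected_restrict.
move=> B /andP[sB]; rewrite connected_restrict // => conB sAB; apply/eqP.
have /set0Pn[x xA] := A0.
by rewrite eqEsubset sAB andbT (nconn_sub fN sA conB sB _ xA) // (subsetP sAB).
Qed.

(** Over an empty ground set [set0] is a maximal connected set, whereas [component] requires a
    nonempty one. *)
Lemma components_component M A : ground M != set0 -> A \in components M ->
  component (nullity M) (ground M) A.
Proof.
have fN := nullityP M.
move=> /set0Pn[x0 x0E]; rewrite inE => /maxsetP[/andP[sA]].
rewrite connected_restrict // => conA maxA.
have /set0Pn[x xA] : A != set0.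
  apply/eqP=> A0; have /setP/(_ x0) : [set x0] = A.
    apply: maxA; rewrite ?A0 ?sub0set //= sub1set x0E connected_restrict ?sub1set //.
    exact: nconn1.
  by rewrite A0 !inE eqxx.
have [B cB xB] := component_at fN (subsetP sA x xA).
have [_ sepB conB] := cB; have sB := component_sub cB.
suff <- : B = A by [].
apply: maxA; first by rewrite /= sB connected_restrict.
exact: (nconn_sub fN sepB conA sA xA xB).
Qed.

End Bridge.

(** * Translation between cycle systems and systems of the nullity *)

Section CycleSystems.
Variables (T : finType) (M : matroid T).
Implicit Types (f : {set T} -> nat) (E A : {set T}).

Lemma cycle_system_sys g (C : 'I_g -> {set T}) :
  cycle_system M C <-> nullity_system (nullity M) (ground M) [set: 'I_g] C.
Proof.
split=> [[eg cC dC]|[cS CE cC dC]]; split.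
- by rewrite cardsT card_ord -corank_nullity.
- by move=> i _; have /matroid_cycleP[] := cC i.
- by move=> i _; have /matroid_cycleP[] := cC i.
- by move=> s _ s0; have := dC s s0; rewrite dependent_nullity => /andP[].
- by rewrite corank_nullity -cS cardsT card_ord.
- by move=> i; apply/matroid_cycleP; split; [apply: CE | apply: cC]; rewrite inE.
move=> s s0; rewrite dependent_nullity dC ?subsetT // andbT.
by apply/subsetP=> z /unique_union_cover[i _]; apply/subsetP/CE; rewrite inE.
Qed.

Lemma eq_sys g f f' E S (C : 'I_g -> {set T}) :
  (forall X : {set T}, X \subset E -> f X = f' X) ->
  nullity_system f E S C -> nullity_system f' E S C.
Proof.
move=> eqf [cS CE cC dC]; split=> //; first by rewrite -eqf.
  move=> i iS x xC; rewrite -!eqf ?cC ?CE //.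
  by apply: subset_trans (CE i iS); apply: subD1set.
move=> s sS s0; rewrite -eqf ?dC //.
by apply/subsetP=> z /unique_union_cover[i /(subsetP sS) iS]; apply/subsetP/CE.
Qed.

Lemma sys_enum g f E S (C : 'I_g -> {set T}) :
  nullity_system f E S C -> nullity_system f E [set: 'I_#|S|] (fun j => C (enum_val j)).
Proof.
move=> [cS CE cC dC]; split.
- by rewrite cardsT card_ord.
- by move=> j _; apply/CE/enum_valP.
- by move=> j _; apply/cC/enum_valP.
move=> s _ s0.
have -> : unique_union (fun j : 'I_#|S| => C (enum_val j)) s =
          unique_union C [set enum_val j | j in s].
  apply/setP=> z; apply/unique_unionP/unique_unionP.
    move=> [j /andP[sj Cj] uni]; exists (enum_val j); first by rewrite imset_f.
    by move=> i /imsetP[k sk ->] Ck; rewrite (uni k).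
  move=> [i /andP[/imsetP[j sj ->] Cj] uni]; exists j; first by rewrite sj.
  by move=> k sk Ck; apply: enum_val_inj; apply: uni => //; apply: imset_f.
apply: dC; first by apply/subsetP=> i /imsetP[j _ ->]; apply: enum_valP.
by case/set0Pn: s0 => j sj; apply/set0Pn; exists (enum_val j); apply: imset_f.
Qed.

End CycleSystems.

(** * The circuit space of a binary matroid *)

Section LinearAlgebra.
Import GRing.Theory.
Local Open Scope ring_scope.

(** Coefficients are indexed by the elements of [s] rather than by positions, which fits sums over
    sets. *)
Lemma free_mapP (F : fieldType) (V : vectType F) (I : eqType) (v : I -> V) (s : seq I) :
  uniq s ->
  reflect (forall a : I -> F, \sum_(x <- s) a x *: v x = 0 -> {in s, forall x, a x = 0})
          (free [seq v x | x <- s]).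
Proof.
move=> us; apply: (iffP (freeP (X := in_tuple [seq v x | x <- s])))
  =>  [h a sum0 x xs|h k sum0 i].
  have ltx : (index x s < size [seq v x | x <- s])%N by rewrite size_map index_mem.
  have := h (fun i => a (nth x s i)) _ (Ordinal ltx); rewrite /= nth_index //; apply.
  rewrite -[RHS]sum0 (big_nth x) big_mkord size_map; apply: eq_bigr => i _ /=.
  by rewrite (nth_map x).
case: s => [|x0 s0] in us k h sum0 i *; first by case: i.
set s := x0 :: s0 in us k h sum0 i *; clearbody s.
(* The coefficient at the position of [y]; the default 0 is taken only off [s]. *)
pose a y := oapp k 0 (insub (index y s)).
have aE (j : 'I_(size [seq v x | x <- s])) : a (nth x0 s j) = k j.
  have ltj : (j < size s)%N by rewrite -(size_map v) ltn_ord.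
  by rewrite /a index_uniq // valK.
rewrite -aE; apply: h; last by apply: mem_nth; rewrite -(size_map v).
rewrite -[RHS]sum0 (big_nth x0) -(size_map v) big_mkord; apply: eq_bigr => j _ /=.
by rewrite aE (nth_map x0) // -(size_map v).
Qed.

Lemma span_ind (F : fieldType) (V : vectType F) (P : V -> Prop) (X : seq V) :
  P 0 -> (forall u w, P u -> P w -> P (u + w)) -> (forall c u, P u -> P (c *: u)) ->
  {in X, forall u, P u} -> {in <<X>>%VS, forall w, P w}.
Proof.
move=> P0 PD PZ PX w wX; rewrite (coord_span (X := in_tuple X) wX).
by apply: big_ind => // i _; apply/PZ/PX/mem_nth.
Qed.

Lemma sum_support (T : finType) (V : nmodType) (A B : {set T}) (F : T -> V) :
  B \subset A -> (forall t, t \in A -> t \notin B -> F t = 0) ->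
  \sum_(t in A) F t = \sum_(t in B) F t.
Proof.
move=> sBA F0; rewrite (big_setID B) (setIidPr sBA) /= [X in _ + X]big1 ?addr0 //.
by move=> t; rewrite inE => /andP[tB tA]; apply: F0.
Qed.

Lemma F2_neq0 (c : 'F_2) : c != 0 -> c = 1.
Proof. by case: c => -[|[|m]] lt c0 //; apply: val_inj. Qed.

Section Binary.
Variables (T : finType) (M : matroid T).
Let E := ground M.

Lemma indicator_sum (A : {set T}) : indicator A = \sum_(t in A) indicator [set t].
Proof.
apply/ffunP=> x; rewrite sum_ffunE ffunE; have [xA|xA] := boolP (x \in A).
  rewrite (bigD1 x) //= ffunE inE eqxx big1 ?addr0 // => t /andP[_ tx].
  by rewrite ffunE inE eq_sym (negbTE tx).
rewrite big1 // => t tA; rewrite ffunE inE.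
by case: eqVneq tA xA => [->|//] ->.
Qed.

Lemma scale_indicator (c : 'F_2) (A : {set T}) x :
  (c *: indicator A) x = c * (x \in A)%:R.
Proof. by rewrite ffunE ffunE. Qed.

Lemma free_indicator1 (A : {set T}) : free [seq indicator [set t] | t <- enum A].
Proof.
apply/free_mapP=> [|a sum0 x]; first exact: enum_uniq.
rewrite mem_enum => xA; move: sum0; rewrite big_enum /= => /ffunP/(_ x).
rewrite sum_ffunE => sumx.
have {sumx} : \sum_(t in A) (a t *: indicator [set t]) x = 0 by rewrite sumx ffunE.
rewrite (bigD1 x xA) /= scale_indicator inE eqxx mulr1.
rewrite big1 => [|t /andP[_ tx]]; first by rewrite addr0.
by rewrite scale_indicator inE eq_sym (negbTE tx) mulr0.
Qed.

Lemma free_cycle_system g (C : 'I_g -> {set T}) : cycle_system M C ->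
  free [seq indicator (C i) | i : 'I_g].
Proof.
case=> _ _ dC; apply/free_mapP=> [|a sum0 i _]; first exact: enum_uniq.
apply/eqP/negPn/negP=> ai.
(* At an element of the unique union over the support, the vanishing sum reduces to a single nonzero
   coefficient. *)
pose s := [set i | a i != 0].
have s0 : s != set0 by apply/set0Pn; exists i; rewrite inE.
have := dC s s0; rewrite dependent_nullity => /andP[_].
have [->|/set0Pn[e /unique_unionP[j /andP[sj Cj] uni]] _] := eqVneq (unique_union C s) set0.
  by rewrite (nul0 (nullityP M)).
move: sum0; rewrite big_enum /= => /ffunP/(_ e).
rewrite sum_ffunE => sume.
have {sume} : \sum_i (a i *: indicator (C i)) e = 0 by rewrite sume ffunE.
rewrite (bigD1 j) //= scale_indicator Cj mulr1.
rewrite big1 => [|k kj]; first by rewrite addr0 => aj0; move: sj; rewrite inE aj0 eqxx.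
rewrite scale_indicator; have [Ck|_] := boolP (e \in C k); last by rewrite mulr0.
have [->|ak] := eqVneq (a k) 0; first by rewrite mul0r.
by move: kj; rewrite (uni k) ?eqxx // inE.
Qed.

(** Vectors of the circuit space are linear relations among the [v t], so none but 0 is supported on
    a basis [B]. The circuit space and the coordinate space of [B] thus form a direct sum inside the
    coordinate space of [E]. *)
Lemma binary_dim : binary M -> (\dim (circuit_space M) + rk M E <= #|E|)%N.
Proof.
case=> n [v repr]; have [B [iB sB Brk]] := rk_basis M E.
have freeP' (I : {set T}) : I \subset E ->
    reflect (forall a : T -> 'F_2, \sum_(x in I) a x *: v x = 0 -> {in I, forall x, a x = 0})
            (indep M I).
  move=> sI; rewrite repr //; apply: (iffP (free_mapP _ (enum_uniq _))) => h a.
    by rewrite -big_enum => /h{}h x; rewrite -mem_enum; apply: h.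
  by rewrite big_enum => /h{}h x; rewrite mem_enum; apply: h.
have circ0 (D : {set T}) : circuit M D -> \sum_(t in D) v t = 0.
  move=> cD; have /minsetP[/andP[sD dD] minD] := cD.
  have [a [sum0 [x [xD ax]]]] : exists a : T -> 'F_2, \sum_(t in D) a t *: v t = 0 /\
      exists x, x \in D /\ a x != 0.
    (* Restricting to the finite type of [ffun] coefficients makes the existence of a nontrivial
       relation decidable. *)
    have [/existsP[a /andP[/eqP sum0 /existsP[x /andP[xD ax]]]]|/existsPn noa] := boolP
        [exists a : {ffun T -> 'F_2},
          (\sum_(t in D) a t *: v t == 0) && [exists x, (x \in D) && (a x != 0)]].
      by exists a; split=> //; exists x.
    case/negP: dD; apply/(freeP' _ sD) => a sum0 x xD.
    have := noa (finfun a); rewrite negb_and.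
    have -> : \sum_(t in D) finfun a t *: v t = 0.
      by rewrite -[RHS]sum0; apply: eq_bigr => t _; rewrite ffunE.
    by rewrite eqxx /= => /existsPn/(_ x); rewrite xD ffunE /= negbK => /eqP.
  (* The support of the relation is dependent, hence all of [D] by minimality; over ['F_2] every
     coefficient is then 1. *)
  pose D' := [set t in D | a t != 0].
  have sD' : D' \subset D by apply/subsetP=> t; rewrite inE => /andP[].
  have eqD : D' = D.
    apply: minD => //; rewrite /dependent (subset_trans sD' sD) /=.
    apply/negP=> /(freeP' _ (subset_trans sD' sD))/(_ a) h.
    have : a x = 0.
      apply: h; last by rewrite inE xD.
      rewrite -[RHS]sum0 -(sum_support sD') // => t tD.
      by rewrite inE tD negbK => /eqP->; apply: scale0r.
    by apply/eqP.
  rewrite -[RHS]sum0; apply: eq_bigr => t; rewrite -eqD inE => /andP[_ /F2_neq0->].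
  by rewrite scale1r.
have W0 : {in circuit_space M, forall w : {ffun T -> ('F_2)^o},
             \sum_(t in E) (w t : 'F_2) *: v t = 0}.
  apply: span_ind.
  - by rewrite big1 // => t _; rewrite ffunE scale0r.
  - move=> u w u0 w0.
    transitivity (\sum_(t in E) (u t : 'F_2) *: v t + \sum_(t in E) (w t : 'F_2) *: v t).
      by rewrite -big_split; apply: eq_bigr => t _ /=; rewrite ffunE scalerDl.
    by rewrite u0 w0 addr0.
  - move=> c u u0.
    transitivity ((c : 'F_2) *: \sum_(t in E) (u t : 'F_2) *: v t).
      by rewrite scaler_sumr; apply: eq_bigr => t _ /=; rewrite ffunE scalerA.
    by rewrite u0 scaler0.
  move=> u /mapP[D]; rewrite mem_enum => cD ->.
  have /circuitP[sD _ _] : circuit M D by [].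
  rewrite -[RHS](circ0 D cD) (sum_support sD) => [|t _ tD].
    by apply: eq_bigr => t tD; rewrite ffunE tD scale1r.
  by rewrite ffunE (negbTE tD) scale0r.
pose delta (A : {set T}) := <<[seq indicator [set t] | t <- enum A]>>%VS.
have dim_delta A : \dim (delta A) = #|A|.
  by have /eqP := free_indicator1 A; rewrite size_map -cardE.
have cap0 : (circuit_space M :&: delta B)%VS = 0%VS.
  apply/eqP; rewrite -subv0; apply/subvP=> w /memv_capP[wW wB].
  have wsupp t : t \notin B -> w t = 0.
    move: w wB {wW}; apply: span_ind.
    - by rewrite ffunE.
    - by move=> u w u0 w0 tB; rewrite ffunE u0 // w0 // addr0.
    - by move=> c u u0 tB; rewrite ffunE u0 // scaler0.
    move=> u /mapP[x]; rewrite mem_enum => xB -> tB; rewrite ffunE inE.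
    by case: eqVneq tB xB => [->|//] /negbTE->.
  rewrite memv0; apply/eqP/ffunP=> t; rewrite [RHS]ffunE.
  have [tB|/wsupp//] := boolP (t \in B).
  have /(freeP' _ sB) := iB; apply=> //.
  by rewrite -[RHS](W0 w wW) -(sum_support sB) // => x _ /wsupp->; rewrite scale0r.
rewrite -Brk -[X in (_ + X)%N]dim_delta -dimv_disjoint_sum //.
rewrite -dim_delta; apply: dimvS; rewrite subv_add; apply/andP; split.
  apply/span_subvP=> u /mapP[D]; rewrite mem_enum => cD ->.
  have /circuitP[sD _ _] : circuit M D by [].
  rewrite indicator_sum; apply: rpred_sum => t tD; apply: memv_span.
  by apply: map_f; rewrite mem_enum (subsetP sD).
apply: sub_span => u /mapP[x]; rewrite mem_enum => xB ->.
by apply: map_f; rewrite mem_enum (subsetP sB).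
Qed.

End Binary.
End LinearAlgebra.

(** * Cycle systems of a matroid *)

Section Main.
Variables (T : finType) (M : matroid T).
Hypothesis E0 : ground M != set0.
Implicit Types (A E X : {set T}).

Lemma mem_bigcup_seq x (s : seq {set T}) :
  x \in \bigcup_(X <- s) X -> exists2 X : {set T}, X \in s & x \in X.
Proof.
elim: s => [|X s IH]; first by rewrite big_nil inE.
rewrite big_cons inE => /orP[xX|/IH[Y YA xY]]; first by exists X; rewrite ?mem_head.
by exists Y; rewrite // inE YA orbT.
Qed.

Lemma has_cycle_system_sys N g S (C : 'I_g -> {set T}) :
  nullity_system (nullity N) (ground N) S C -> has_cycle_system N.
Proof.
by move=> sC; exists #|S|, (fun j => C (enum_val j)); apply/cycle_system_sys/sys_enum.
Qed.

Lemma has_cycle_system_delete e g S (C : 'I_g -> {set T}) :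
  nullity_system (nullity M) (ground M :\ e) S C -> has_cycle_system (delete M e).
Proof.
move=> sC; apply: (has_cycle_system_sys (S := S) (C := C)).
rewrite /= (setIidPr (subD1set _ _)).
by apply: eq_sys sC => X sX; rewrite nullity_restrict.
Qed.

Lemma has_cycle_system_contract e g S (C : 'I_g -> {set T}) : e \in ground M ->
  nullity_system (contr (nullity M) e) (ground M :\ e) S C -> has_cycle_system (contract M e).
Proof.
move=> eE sC; apply: (has_cycle_system_sys (S := S) (C := C)).
by apply: eq_sys sC => X sX; rewrite nullity_contract.
Qed.

Lemma nullity_system0 f E g (C : 'I_g -> {set T}) : f E = 0 -> nullity_system f E set0 C.
Proof.
move=> f0; split=> [|i|i|s]; rewrite ?cards0 ?inE //.
by rewrite subset0 => /eqP->; rewrite eqxx.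
Qed.

(** An element private to one member serves for both minors; without members the nullity is 0, and
    any element does. *)
Lemma minors_have_cycle_system g (C : 'I_g -> {set T}) : cycle_system M C ->
  exists e, [/\ e \in ground M, has_cycle_system (delete M e) & has_cycle_system (contract M e)].
Proof.
move/cycle_system_sys=> sC; have fN := nullityP M.
have [T0|T0] := eqVneq [set: 'I_g] set0.
  have f0 : nullity M (ground M) = 0 by rewrite -(sys_card sC) T0 cards0.
  have /set0Pn[e eE] := E0; exists e; split=> //.
    apply: (has_cycle_system_delete (nullity_system0 C _)); apply/eqP; rewrite -leqn0 -f0.
    exact: nulS fN _ _ (subD1set _ _).
  by apply: (has_cycle_system_contract eE (nullity_system0 C _)); rewrite /contr setD1K // f0.
have [e [i [iS Ci _ uni]]] := sys_dep_ex fN sC (subxx _) T0.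
have eE := subsetP (sys_sub sC iS) e Ci.
have sD := sysD1 fN sC iS Ci uni.
exists e; split=> //; first exact: has_cycle_system_delete sD.
have [fe|loop] := posnP (nullity M [set e]).
  exact: has_cycle_system_contract eE (sys_contr fN sC eE fe).
(* For a loop, [contr] agrees with the nullity on sets missing [e], so the system of the deletion is
   reused. *)
apply: (has_cycle_system_contract (S := [set: 'I_g] :\ i) (C := C) eE).
apply: eq_sys sD => X sX.
have eX : e \notin X by apply/negP=> /(subsetP sX); rewrite !inE eqxx.
have s1 : X :|: [set e] \subset e |: X by set_sub.
have s2 : X :&: [set e] \subset set0 by set_sub.
rewrite /contr; have := super_disjoint fN s1 s2; have := nulU1 fN e X; nat_lia.
Qed.

Lemma connected_circuits g (C : 'I_g -> {set T}) : cycle_system M C ->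
  connected M -> forall i, circuit M (C i).
Proof.
move/cycle_system_sys=> sC; rewrite connected_nconn => conM i; have fN := nullityP M.
have [A [[A0 sA _] _ circA]] := tight_component fN sC E0.
have AE : A = ground M by case: (nconnP conM sA) => // A00; rewrite A00 eqxx in A0.
apply/circuitP; split; [exact: (sys_sub sC)|exact: (sys_cyc sC)|].
by apply: circA; apply/insideP; rewrite AE (sys_sub sC).
Qed.

(** The free family lies in the circuit space, and its length is the corank, which bounds the
    dimension by [binary_dim]. *)
Lemma binary_basis g (C : 'I_g -> {set T}) : cycle_system M C ->
  connected M -> binary M -> basis_of (circuit_space M) [seq indicator (C i) | i : 'I_g].
Proof.
move=> cC conM binM; rewrite basisEfree (free_cycle_system cC) /=; apply/andP; split.
  apply/span_subvP=> u /mapP[i _ ->]; apply/memv_span/map_f.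
  by rewrite mem_enum; apply: connected_circuits.
have [eg _ _] := cC.
rewrite size_map -cardE card_ord eg corank_nullity /nullity.
by have := binary_dim binM; nat_lia.
Qed.

Lemma cycle_system_restrict A g' (F : 'I_g' -> {set T}) : A \subset ground M ->
  nullity_system (nullity M) A [set: 'I_g'] F -> cycle_system (restrict M A) F.
Proof.
move=> sA sF; apply/cycle_system_sys; rewrite /= (setIidPr sA).
by apply: eq_sys sF => X sX; rewrite nullity_restrict.
Qed.

Lemma cycle_restrict A X : A \subset ground M -> X \subset A -> ncycle (nullity M) X ->
  matroid_cycle (restrict M A) X.
Proof.
move=> sA sX cX; apply/matroid_cycleP; rewrite /= (setIidPr sA); split=> // x xX.
by rewrite !nullity_restrict // ?cX // (subset_trans (subD1set _ _) sX).
Qed.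

Lemma circuit_restrict A X : A \subset ground M -> X \subset A -> ncycle (nullity M) X ->
  nullity M X = 1 -> circuit (restrict M A) X.
Proof.
move=> sA sX cX X1; apply/circuitP; rewrite /= (setIidPr sA) nullity_restrict //.
split=> // x xX; rewrite !nullity_restrict // ?cX //.
by rewrite (subset_trans (subD1set _ _) sX).
Qed.

(** * The decomposition of a cycle system along the components *)

Section Assembly.
Variables (g : nat) (C : 'I_g -> {set T}).
Hypothesis sC : nullity_system (nullity M) (ground M) [set: 'I_g] C.
Variables (r : seq {set T}) (a : 'I_g -> nat).
Hypothesis dec : decomp (nullity M) (ground M) [set: 'I_g] C r a.
Let fN := nullityP M.
Let B i := nth set0 r i.
Let own l := C l :&: B (a l).

Lemma part_component i : i < size r -> component (nullity M) (ground M) (B i).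
Proof. by move=> lti; apply: (dec_comp dec); apply: mem_nth. Qed.

Lemma position_lt l : a l < size r.
Proof. by rewrite (dec_size dec) ?inE. Qed.

Lemma part_disjoint i j : i < size r -> j < size r -> i != j -> B i :&: B j = set0.
Proof.
move=> lti ltj; rewrite neq_ltn => /orP[lt|lt]; first by rewrite (dec_disj dec) ?lt.
by rewrite setIC (dec_disj dec) ?lt.
Qed.

Lemma part_inj i j x : i < size r -> j < size r -> x \in B i -> x \in B j -> i = j.
Proof.
move=> lti ltj xi xj; apply/eqP/negPn/negP=> /(part_disjoint lti ltj)/setP/(_ x).
by rewrite !inE xi xj.
Qed.

Lemma own_neq0 l : own l != set0.
Proof.
have [_ o1] := dec_cyc dec (in_setT l).
by apply/eqP=> o0; move: o1; rewrite -/(B _) -/(own l) o0 (nul0 fN).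
Qed.

(** Equal traces share their position, the parts being disjoint, and would then have an empty unique
    union. Injectivity lets [K] recover a member from its circuit. *)
Lemma own_inj : injective own.
Proof.
move=> l m eqo; have /set0Pn[x xl] := own_neq0 l.
have xm : x \in own m by rewrite -eqo.
have ea : a l = a m.
  by move: xl xm => /setIP[_ xl] /setIP[_ xm];
    apply: part_inj (position_lt l) (position_lt m) xl xm.
apply/eqP/negPn/negP=> nlm.
have eqB : C l :&: nth set0 r (a l) = C m :&: nth set0 r (a l) by rewrite {2}ea.
have lm0 : [set l; m] != set0 by apply/set0Pn; exists l; rewrite set21.
have al k : k \in [set l; m] -> a k = a l by rewrite !inE => /orP[]/eqP->.
have := dec_uu dec (subsetT _) al lm0.
by rewrite unique_union_pair // (nul0 fN).
Qed.

Lemma members_inj : injective C.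
Proof.
move=> l m eqC; apply/eqP/negPn/negP=> nlm.
have lm0 : [set l; m] != set0 by apply/set0Pn; exists l; rewrite set21.
by have := sys_dep sC (subsetT _) lm0; rewrite unique_union_pair // (nul0 fN).
Qed.

Let k := size r.
Let c (i : 'I_k) := #|[set l in [set: 'I_g] | a l == i]|.
Let D (i : 'I_k) (j : 'I_(c i)) : {set T} := C (enum_val j) :&: B i.
(** The residue is a function of the circuit instead of the index; a set that is no [own l] gets the
    default [set0]. *)
Let K (X : {set T}) : {set T} :=
  if [pick l | own l == X] is Some l then C l :\: X else set0.

Lemma residue_own l : K (own l) = C l :\: B (a l).
Proof.
rewrite /K; case: pickP => [m /eqP/own_inj->|/(_ l)]; last by rewrite eqxx.
by rewrite setDIr setDv set0U.
Qed.

Lemma position_enum_val (i : 'I_k) (j : 'I_(c i)) : a (enum_val j) = i.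
Proof. by have := enum_valP j; rewrite inE => /andP[_ /eqP]. Qed.

Lemma part_own (i : 'I_k) (j : 'I_(c i)) : D j = own (enum_val j).
Proof. by rewrite /own position_enum_val. Qed.

Lemma residueU_own (i : 'I_k) (j : 'I_(c i)) : K (D j) :|: D j = C (enum_val j).
Proof. by rewrite part_own residue_own setUC setID. Qed.

Lemma image_residueU (i : 'I_k) :
  [set K (D j) :|: D j | j : 'I_(c i)] = [set C l | l in [set l : 'I_g | a l == i]].
Proof.
apply/setP=> X; apply/imsetP/imsetP=> [[j _ ->]|[l al ->]].
  by exists (enum_val j); rewrite ?residueU_own // inE position_enum_val.
have lS : l \in [set l in [set: 'I_g] | a l == i] by rewrite !inE in al *.
by exists (enum_rank_in lS l); rewrite // residueU_own enum_rankK_in.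
Qed.

Lemma residue_before l : C l :\: B (a l) \subset \bigcup_(j < k | j < a l) B j.
Proof.
apply/subsetP=> x; rewrite inE => /andP[xB xC].
have /mem_bigcup_seq[X /(nthP set0)[j ltj <-] xX] := subsetP (dec_sub dec (in_setT l)) x xC.
rewrite size_takel ?position_lt // in ltj; rewrite nth_take // in xX.
have ltja : j < a l.
  rewrite ltn_neqAle -ltnS ltj andbT.
  by apply: contraNneq xB => <-.
have ltjk : j < k by apply: ltn_trans ltja (position_lt l).
by apply/bigcupP; exists (Ordinal ltjk).
Qed.

Lemma circuit_system_part (i : 'I_k) : circuit_system (restrict M (B i)) (@D i).
Proof.
have sB := component_sub (part_component (ltn_ord i)).
split; last first.
  move=> j; have := dec_cyc dec (in_setT (enum_val j)); rewrite position_enum_val => -[cD D1].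
  by apply: circuit_restrict => //; apply: subsetIr.
apply: cycle_system_restrict sB _.
apply: (sys_enum (S := [set l in [set: 'I_g] | a l == i]) (C := fun l => C l :&: B i)).
split.
- exact: (dec_card dec).
- by move=> l _; apply: subsetIr.
- move=> l; rewrite !inE => /eqP al; have := dec_cyc dec (in_setT l).
  by rewrite al => -[].
move=> s sS; apply: (dec_uu dec); first exact: subsetT.
by move=> l /(subsetP sS); rewrite !inE => /eqP.
Qed.

Lemma parts_components : [set B i | i : 'I_k] = components M.
Proof.
apply/setP=> X; apply/imsetP/idP=> [[i _ ->]|].
  exact/component_components/part_component.
move/(components_component E0)=> cX; have [X0 sX conX] := cX; have sXE := component_sub cX.
have /set0Pn[x xX] := X0.
have := subsetP sXE x xX; rewrite {1}(dec_cover dec) => /mem_bigcup_seq[Y Yr xY].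
have cY := dec_comp dec Yr; have [_ sY conY] := cY; have sYE := component_sub cY.
have XY : X = Y.
  apply/eqP; rewrite eqEsubset (nconn_sub fN sY conX sXE xX xY).
  exact: (nconn_sub fN sX conY sYE xY xX).
have ltY : index Y r < k by rewrite index_mem.
by exists (Ordinal ltY); rewrite // /B nth_index.
Qed.

(** Nullity is additive over the parts, so it vanishes exactly when every summand does. *)
Lemma parts_direct_sum : is_direct_sum M (fun i : 'I_k => restrict M (B i)).
Proof.
have EB (i : 'I_k) : ground M :&: B i = B i.
  exact/setIidPr/component_sub/part_component.
split=> [|i j nij|I sI].
- rewrite {1}(dec_cover dec) (big_nth set0) big_mkord.
  by apply: eq_bigr => i _; rewrite /= EB.
- by rewrite /= !EB -setI_eq0 part_disjoint.
rewrite indep_nullity (dec_sum dec sI) (big_nth set0) big_mkord sum_nat_eq0.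
apply: eq_forallb => i /=; rewrite EB /restrict_indep /= subsetIr andbT.
by rewrite -/(B i) indep_nullity.
Qed.

Lemma cycle_system_decomposition :
  exists (k : nat) (E : 'I_k -> {set T}) (c : 'I_k -> nat)
         (D : forall i : 'I_k, 'I_(c i) -> {set T}) (K : {set T} -> {set T}),
    let Dtilde (i : 'I_k) : {set {set T}} := [set K (D i j) :|: D i j | j : 'I_(c i)] in
    [/\ injective E /\ [set E i | i : 'I_k] = components M,
        is_direct_sum M (fun i : 'I_k => restrict M (E i)),
        forall i : 'I_k, circuit_system (restrict M (E i)) (D i),
        forall (i : 'I_k) (j : 'I_(c i)),
          K (D i j) = set0 \/
          matroid_cycle (restrict M (\bigcup_(l < k | l < i) E l)) (K (D i j))
      & [/\ [set C i | i : 'I_g] = \bigcup_(i < k) Dtilde i,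
            forall i i' : 'I_k, i != i' -> [disjoint Dtilde i & Dtilde i']
          & forall i : 'I_k, i = 0 :> nat -> Dtilde i = [set D i j | j : 'I_(c i)]]].
Proof.
exists k, (fun i => B i), c, D, K => /=; split.
- split; last exact: parts_components.
  move=> i j eqB; apply: val_inj; have [/set0Pn[x xB] _ _] := part_component (ltn_ord i).
  by apply: (part_inj (ltn_ord i) (ltn_ord j) xB); rewrite -eqB.
- exact: parts_direct_sum.
- exact: circuit_system_part.
- move=> i j; right; rewrite part_own residue_own; set l := enum_val j.
  apply: cycle_restrict.
  + by apply/bigcupsP=> m _; apply/component_sub/part_component.
  + by rewrite -[i : nat](position_enum_val j); apply: residue_before.
  (* Removing a separator from a cycle leaves a cycle. *)
  have [_ sB _] := part_component (position_lt l).
  by apply: ncycleD sB _ _ => //; [apply: (sys_cyc sC) | apply: (sys_sub sC)].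
split.
- apply/setP=> X; apply/imsetP/bigcupP=> [[l _ ->]|[i _]].
    by exists (Ordinal (position_lt l)); rewrite // image_residueU imset_f // inE.
  by rewrite image_residueU => /imsetP[l _ ->]; exists l.
- move=> i i' nii; rewrite !image_residueU -setI_eq0; apply/eqP/setP=> X; rewrite in_set0.
  apply/negP=> /setIP[/imsetP[l al ->] /imsetP[m am /members_inj lm]].
  move: al am nii; rewrite lm !inE => /eqP al /eqP am /eqP[]; apply: val_inj.
  by rewrite /= -al.
(* No part precedes the first one, so the residues there are empty. *)
move=> i i0; apply: eq_imset => j.
have : K (D j) \subset set0.
  rewrite part_own residue_own; apply: subset_trans (residue_before _) _.
  by apply/bigcupsP=> m; rewrite position_enum_val i0.
by rewrite subset0 => /eqP->; rewrite set0U.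
Qed.

End Assembly.

End Main.

Theorem theorem1 (T : finType) (M : matroid T) (hM : ground M != set0)
    (g : nat) (C : 'I_g -> {set T}) (hC : cycle_system M C) :
  [/\ exists e : T, [/\ e \in ground M,
        has_cycle_system (delete M e) & has_cycle_system (contract M e)],
      connected M -> forall i : 'I_g, circuit M (C i),
      ~~ connected M ->
        exists (k : nat) (E : 'I_k -> {set T}) (c : 'I_k -> nat)
               (D : forall i : 'I_k, 'I_(c i) -> {set T})
               (K : {set T} -> {set T}),
          let Dtilde (i : 'I_k) : {set {set T}} :=
            [set K (D i j) :|: D i j | j : 'I_(c i)] in
          [/\ injective E /\ [set E i | i : 'I_k] = components M,
              is_direct_sum M (fun i : 'I_k => restrict M (E i)),
              forall i : 'I_k, circuit_system (restrict M (E i)) (D i),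
              forall (i : 'I_k) (j : 'I_(c i)),
                K (D i j) = set0 \/
                matroid_cycle (restrict M (\bigcup_(l < k | l < i) E l)) (K (D i j))
            & [/\ [set C i | i : 'I_g] = \bigcup_(i < k) Dtilde i,
                  forall i i' : 'I_k, i != i' ->
                    [disjoint Dtilde i & Dtilde i']
                & forall i : 'I_k, i = 0 :> nat ->
                    Dtilde i = [set D i j | j : 'I_(c i)]]]
    & connected M /\ binary M ->
        basis_of (circuit_space M) [seq indicator (C i) | i : 'I_g]].
Proof.
split.
- exact: minors_have_cycle_system hC.
- exact: connected_circuits hC.
- move=> _; have sC := (cycle_system_sys M C).1 hC.
  have [r [a dec]] := decomp_exists (nullityP M) sC.
  exact: cycle_system_decomposition dec.
by case; apply: binary_basis.
Qed.
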